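(* Let $X_1$ and $X_2$ be two independent Lévy processes on $\mathbf{R}^n$. If $X_1$ satisfies Hunt's hypothesis (H) and $X_2$ is a compound Poisson process, then $X_1+X_2$ satisfies Hunt's hypothesis (H).
   Context: A compound Poisson process on $\mathbf{R}^n$ is a Lévy process with $E[e^{i\langle z,X_t\rangle}]=\exp\{-t\int_{\mathbf{R}^n}(1-e^{i\langle z,x\rangle})\mu(dx)\}$ for a finite measure $\mu$ on $\mathbf{R}^n\setminus\{0\}$ (no drift and no Gaussian part). Hunt's hypothesis (H) for a Lévy process $X$: every semipolar set of $X$ is polar. Here $P^x$ is the law of the process started at $x$ (i.e. of $x+X$), $T_B=\inf\{t>0: X_t\in B\}$. A set $B$ is polar if it is contained in a nearly Borel set $C$ with $P^x(T_C<\infty)=0$ for all $x$; thin if it is contained in a nearly Borel set $C$ with $P^x(T_C=0)=0$ for all $x$; semipolar if it is contained in a countable union of thin sets. *)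

(* Defs.v *)
From mathcomp Require Import all_boot all_order all_algebra.
From mathcomp Require Import all_classical all_reals all_analysis.
From mathcomp.real_closed Require Import complex.
Import Order.TTheory GRing.Theory Num.Theory.
Import numFieldNormedType.Exports.

Set Implicit Arguments.
Unset Strict Implicit.
Unset Printing Implicit Defensive.

Local Open Scope classical_set_scope.
Local Open Scope ring_scope.

(* R^n with its Borel sigma-algebra.  The carrier is 'rV[R]_n itself, so that
   functions with values in 'rV[R]_n can be ascribed this type. *)
Notation Rn R n := (g_sigma_algebraType (@open 'rV[R]_n)).

Definition borel (R : realType) (n : nat) (B : set 'rV[R]_n) : Prop :=
  measurable (B : set (Rn R n)).

Definition dotp (R : realType) (n : nat) (z x : 'rV[R]_n) : R :=
  \sum_(i < n) z ord0 i * x ord0 i.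

Definition cexp (R : realType) (w : R[i]) : R[i] :=
  Complex (expR (complex.Re w) * cos (complex.Im w)) (expR (complex.Re w) * sin (complex.Im w)).

Definition cis (R : realType) (a : R) : R[i] := cexp (Complex 0 a).

Definition cintegral (d : measure_display) (T : measurableType d)
    (R : realType) (mu : {measure set T -> \bar R}) (f : T -> R[i]) : R[i] :=
  Complex (Rintegral mu setT (fun x => complex.Re (f x)))
          (Rintegral mu setT (fun x => complex.Im (f x))).

(* A process is a function X : R -> T -> 'rV[R]_n; only the times t >= 0 are
   ever used. *)

Section processes.
Context (d : measure_display) (T : measurableType d) (R : realType).
Variables (P : probability T R) (n : nat).
Implicit Types (X Y : R -> T -> 'rV[R]_n) (B C : set 'rV[R]_n).

Definition independent_family (k : nat) (Z : 'I_k -> T -> 'rV[R]_n) : Prop :=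
  forall (J : {set 'I_k}) (B : 'I_k -> set 'rV[R]_n),
    (forall i, borel (B i)) ->
    (P (\bigcap_(i in [set` J]) (Z i @^-1` B i)) =
     \prod_(i in J) P (Z i @^-1` B i))%E.

Definition cadlag (g : R -> 'rV[R]_n) : Prop :=
  (forall t, 0 <= t -> g s @[s --> t^'+] --> g t) /\
  (forall t, 0 < t -> cvg (g s @[s --> t^'-])).

Definition levy_process X : Prop :=
  [/\ (forall t, 0 <= t -> measurable_fun setT (X t : T -> Rn R n)),
      {ae P, forall w, X 0 w = 0},
      (forall (k : nat) (t : nat -> R),
         0 <= t 0%N -> (forall i, t i < t i.+1) ->
         independent_family (fun i : 'I_k => fun w => X (t i.+1) w - X (t i) w))
    & [/\ (forall s t B, 0 <= s -> 0 <= t -> borel B ->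
             P [set w | B (X (s + t) w - X s w)] = P [set w | B (X t w)]),
          (forall t e, 0 <= t -> 0 < e ->
             P [set w | e < `|X s w - X t w|]
               @[s --> within [set s | 0 <= s] (nbhs t)] --> 0%E)
        & {ae P, forall w, cadlag (fun t => X t w)}]].

Definition compound_poisson X : Prop :=
  levy_process X /\
  exists mu : {finite_measure set (Rn R n) -> \bar R},
    mu [set 0] = 0%E /\
    forall (t : R) (z : 'rV[R]_n), 0 <= t ->
      cintegral P (fun w => cis (dotp z (X t w))) =
      cexp (- (Complex t 0 * cintegral mu (fun x => 1 - cis (dotp z x)))).

Definition process_sigma X : set (set T) :=
  <<s [set A | exists t B, [/\ 0 <= t, borel B & A = X t @^-1` B]] >>.

Definition independent_processes X Y : Prop :=
  forall A A', process_sigma X A -> process_sigma Y A' ->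
    (P (A `&` A') = P A * P A')%E.

Definition started_at (x : 'rV[R]_n) X : R -> T -> 'rV[R]_n :=
  fun t w => x + X t w.

(* The infimum of the empty set is +oo. *)
Definition hitting_time X B (w : T) : \bar R :=
  ereal_inf [set t%:E | t in [set t : R | 0 < t /\ B (X t w)]].

(* The law P^nu of the process with initial distribution nu is the image of
   nu \x P under (x, w) |-> (x + X t w)_t.  Here and below, "probability zero"
   is negligibility, i.e. nullity for the completed measure, because the
   hitting events need not belong to the uncompleted sigma-algebra. *)
Definition nearly_borel X C : Prop :=
  forall nu : probability (Rn R n) R, exists C1 C2 : set 'rV[R]_n,
    [/\ borel C1, borel C2, C1 `<=` C, C `<=` C2
      & (nu \x P)%E.-negligible
          [set xw : Rn R n * T |
             exists t : R, 0 <= t /\ (C2 `\` C1) (started_at xw.1 X t xw.2)]].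

Definition polar X B : Prop :=
  exists C, [/\ nearly_borel X C, B `<=` C
    & forall x : 'rV[R]_n,
        P.-negligible [set w | (hitting_time (started_at x X) C w < +oo)%E]].

Definition thin X B : Prop :=
  exists C, [/\ nearly_borel X C, B `<=` C
    & forall x : 'rV[R]_n,
        P.-negligible [set w | hitting_time (started_at x X) C w = 0%E]].

Definition semipolar X B : Prop :=
  exists N : nat -> set 'rV[R]_n,
    (forall k, thin X (N k)) /\ B `<=` \bigcup_k N k.

Definition hunt_H X : Prop := forall B, semipolar X B -> polar X B.

End processes.

(* Main.v *)
(* Almost surely the compound Poisson process X2 vanishes on some [0, e[ and all its values
   are already taken at dyadic times. The first fact makes the sets that are thin for X1 + X2
   thin for X1, so semipolar sets for X1 + X2 are semipolar, hence polar, for X1. By the second,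
   x + X1 + X2 can hit C only if (x + X2_q) + X1 does for some dyadic q, and since X2_q is
   independent of X1 this is excluded when C is polar for X1.
   The characteristic function enters only through P(X2_t <> 0) <= c t, obtained by averaging
   1 - E cos<z, X2_t> <= c t over z.  Fubini arguments with hitting events require that
   these are measurable, up to null sets, with respect to the sigma-algebra of X1: this is
   the measurable projection theorem, which is proved via Suslin schemes and capacities.
   Near Borel sets of X1 + X2 are near Borel for X1 because X2 vanishes on [0, K] with
   positive probability, independently of X1. *)

Require Import Defs.
From mathcomp Require Import all_boot all_order all_algebra.
From mathcomp Require Import all_classical all_reals all_analysis measurable_realfun.
From mathcomp Require Import ring lra zify.
From mathcomp.real_closed Require Import complex.
Import Order.TTheory GRing.Theory Num.Theory.
Import numFieldNormedType.Exports.
Set Implicit Arguments.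
Unset Strict Implicit.
Unset Printing Implicit Defensive.
Local Open Scope classical_set_scope.
Local Open Scope ring_scope.

(** * Suslin sets and measurable projection *)

(** Independence concerns only the sigma-algebras generated by the two processes, whereas a
    negligible set of the underlying space may depend on both. Such a set cannot be pulled back
    along (x, w) |-> (x + X2_q(w), w). Each negligible hitting event of X1 is therefore first
    enclosed in a null set of the product of the Borel sets with the sigma-algebra of X1, up to the
    paths that are not cadlag. The projection theorem is stated accordingly: it is enough that every
    measurable subset of the projection is null, and to such subsets Fubini and independence do
    apply. Near Borel envelopes depend on the initial law, so they must be taken for the law of x +
    X2_q, separately for each dyadic q; they can be combined because these q are countably many. *)

Lemma seq_choice (G : seq nat -> Prop) :
  G [::] -> (forall s, G s -> exists v, G (rcons s v)) ->
  exists b : nat -> nat, forall n, G (mkseq b n).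
Proof.
move=> G0 GS.
have /choice[v Gv] : forall s, exists v, G s -> G (rcons s v).
  by move=> s; have [/GS[v ?]|?] := pselect (G s); [exists v|exists 0%N].
pose f n := iter n (fun s => rcons s (v s)) [::].
exists (fun n => v (f n)) => n.
suff -> : mkseq (fun n => v (f n)) n = f n by elim: n => //= n /Gv.
elim: n => //= n IH.
by rewrite -[in RHS]IH /mkseq -addn1 iotaD map_cat cats1 add0n /= -/(mkseq _ _) IH.
Qed.

(* This pairing increases with n for fixed i, so in suslin_bigcap the k-th set of the
   interleaved scheme depends only on the first k terms of the interleaved sequence. *)
Definition pairn (i n : nat) : nat := (2 ^ i * n.*2.+1).-1.
Definition unpairn1 (k : nat) : nat := logn 2 k.+1.
Definition unpairn2 (k : nat) : nat := (k.+1 %/ 2 ^ unpairn1 k)./2.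

Lemma pairnS i n : (pairn i n).+1 = (2 ^ i * n.*2.+1)%N.
Proof. by rewrite /pairn prednK // muln_gt0 expn_gt0. Qed.

Lemma pairnK1 i n : unpairn1 (pairn i n) = i.
Proof.
rewrite /unpairn1 pairnS mulnC logn_Gauss ?lognX ?muln1 //.
by rewrite coprime2n /= odd_double.
Qed.

Lemma pairnK2 i n : unpairn2 (pairn i n) = n.
Proof.
by rewrite /unpairn2 pairnK1 pairnS mulKn ?expn_gt0 //= uphalf_double.
Qed.

Lemma unpairnK k : pairn (unpairn1 k) (unpairn2 k) = k.
Proof.
apply/eqP; rewrite -eqSS pairnS; apply/eqP.
have [] // := @pfactor_coprime 2 k.+1 => m cm kE.
rewrite /unpairn2 /unpairn1 {2}kE mulnK ?expn_gt0 // [RHS]kE mulnC; congr (_ * _)%N.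
have om : odd m by rewrite -coprime2n.
by rewrite -[RHS](odd_double_half m) om.
Qed.

Lemma ltn_pairn i m n : (m < n)%N -> (pairn i m < pairn i n)%N.
Proof.
by move=> mn; rewrite -ltnS !pairnS ltn_pmul2l ?expn_gt0 // ltnS ltn_double.
Qed.

Section projection.
Context (R : realType) (d : measure_display) (S : measurableType d).
Implicit Types (A : set (R * S)) (Z : set (R * S)).

Definition closed_rect Z := exists (C : set R) (F : set S),
  [/\ closed C, measurable F & Z = C `*` F].

(** A Suslin scheme over closed rectangles, with the finite sequence indexing each set replaced by
    an infinite one of which only a prefix counts. Regrouping indices is then a composition of
    functions. *)
Definition suslin A := exists Q : nat -> (nat -> nat) -> set (R * S),
  [/\ forall n s t, (forall i, (i < n)%N -> s i = t i) -> Q n s = Q n t,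
      forall n s, closed_rect (Q n s)
    & A = [set x | exists s, forall n, Q n s x]].

Lemma closed_rectT : closed_rect setT.
Proof. by exists setT, setT; split; [exact: closedT|exact: measurableT|rewrite setXTT]. Qed.

Lemma closed_rect0 : closed_rect set0.
Proof. by exists set0, set0; split; [exact: closed0|exact: measurable0|rewrite set0X]. Qed.

Lemma suslin_rect Z : closed_rect Z -> suslin Z.
Proof.
move=> rZ; exists (fun _ _ => Z); split => //.
apply/seteqP; split => x /= ; first by exists (fun=> 0%N).
by move=> [s /(_ 0%N)].
Qed.

(** The first index selects a member of the union and the later ones run its scheme; level 0, which
    may read no index, is filled with [setT]. *)
Lemma suslin_bigcup (A : nat -> set (R * S)) :
  (forall i, suslin (A i)) -> suslin (\bigcup_i A i).
Proof.
move=> /choice[Q QA].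
exists (fun n s => if n is m.+1 then Q (s 0%N) m (s \o succn) else setT); split.
- case=> // n s t st; rewrite st //; have [QE _ _] := QA (t 0%N); apply: QE.
  by move=> i ni /=; rewrite st.
- case=> [s|n s]; first exact: closed_rectT.
  by have [_ + _] := QA (s 0%N); exact.
- apply/seteqP; split => x /=.
  + move=> [i _]; have [_ _ ->] := QA i; move=> [s Qx].
    exists (fun n => if n is m.+1 then s m else i) => -[//|n].
    exact: Qx.
  + move=> [s Qx]; exists (s 0%N) => //; have [_ _ ->] := QA (s 0%N).
    by exists (s \o succn) => n; exact: (Qx n.+1).
Qed.

Lemma suslin_bigcap (A : nat -> set (R * S)) :
  (forall i, suslin (A i)) -> suslin (\bigcap_i A i).
Proof.
move=> /choice[Q QA].
exists (fun k s => Q (unpairn1 k) (unpairn2 k) (s \o pairn (unpairn1 k))); split.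
- move=> k s t st; have [QE _ _] := QA (unpairn1 k); apply: QE => j jk /=.
  by apply: st; rewrite -[ltnRHS]unpairnK ltn_pairn.
- by move=> k s; have [_ + _] := QA (unpairn1 k); exact.
- apply/seteqP; split => x /=.
  + move=> Ax; have /choice[s Qx] : forall i, exists s, forall n, Q i n s x.
      by move=> i; have := Ax i Logic.I; have [_ _ ->] := QA i.
    exists (fun k => s (unpairn1 k) (unpairn2 k)) => k.
    rewrite (_ : _ \o _ = s (unpairn1 k)); first exact: Qx.
    by apply/funext => j /=; rewrite pairnK1 pairnK2.
  + move=> [s Qx] i _; have [_ _ ->] := QA i; exists (s \o pairn i) => n.
    by have := Qx (pairn i n); rewrite pairnK1 pairnK2.
Qed.

(** Suslin sets are not stable under complement, but those whose complement is Suslin too form a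
    sigma-algebra, so only generators remain to be checked. *)
Let bisuslin A := suslin A /\ suslin (~` A).

Let bisuslin0 : bisuslin set0.
Proof.
split; first exact/suslin_rect/closed_rect0.
by rewrite setC0; exact/suslin_rect/closed_rectT.
Qed.

Let bisuslinC A : bisuslin A -> bisuslin (~` A).
Proof. by move=> [? ?]; split => //; rewrite setCK. Qed.

Let bisuslin_bigcup (A : nat -> set (R * S)) :
  (forall i, bisuslin (A i)) -> bisuslin (\bigcup_i A i).
Proof.
move=> sA; split; first by apply: suslin_bigcup => i; case: (sA i).
by rewrite setC_bigcup; apply: suslin_bigcap => i; case: (sA i).
Qed.

Let bisuslinI A B : bisuslin A -> bisuslin B -> bisuslin (A `&` B).
Proof.
move=> sA sB; rewrite -[_ `&` _]setCK setCI; apply: bisuslinC; rewrite -bigcup2E.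
apply: bisuslin_bigcup => -[|[|i]] /=; [exact: bisuslinC|exact: bisuslinC|].
exact: bisuslin0.
Qed.

Let bisuslinT (F : set S) : measurable F -> bisuslin (setT `*` F).
Proof.
move=> mF; split; first by apply: suslin_rect; exists setT, F.
rewrite (_ : ~` _ = setT `*` ~` F); last first.
  by apply/seteqP; split => -[x y] /=; tauto.
by apply: suslin_rect; exists setT, (~` F); split => //; exact: measurableC.
Qed.

Let bisuslin_ray x : bisuslin (`[x, +oo[%classic `*` setT).
Proof.
split.
  by apply: suslin_rect; exists `[x, +oo[%classic, setT; split => //; exact: rray_closed.
rewrite (_ : ~` _ = \bigcup_n (`]-oo, x - n.+1%:R^-1]%classic `*` setT)).
  apply: suslin_bigcup => n; apply: suslin_rect; eexists _, setT; split; [|by []|by []].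
  exact: lray_closed.
apply/seteqP; split => -[y w] /=; rewrite !in_itv /= andbT.
- move=> yx; have {}yx : y < x by rewrite ltNge; apply/negP => ?; apply: yx.
  exists (Num.truncn (x - y)^-1) => //; rewrite /= in_itv /=; split => //.
  rewrite lerBrDl -lerBrDr invf_ple ?posrE ?subr_gt0 //.
  exact/ltW/truncnS_gt.
- move=> [n _ []] /=; rewrite in_itv /= => yx _ [xy _]; move: xy; apply/negP.
  by rewrite -ltNge (le_lt_trans yx) // ltrBlDr ltrDl invr_gt0.
Qed.

Lemma measurable_suslin A : measurable A -> suslin A.
Proof.
suff : measurable `<=` bisuslin by move=> h /h[].
rewrite measurable_prod_measurableType; apply: smallest_sub.
  split.
  - exact: bisuslin0.
  - by move=> B /bisuslinC; rewrite setTD.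
  - exact: bisuslin_bigcup.
move=> _ [B mB [F mF <-]].
rewrite (_ : _ `*` _ = (B `*` setT) `&` (setT `*` F)); last first.
  by apply/seteqP; split => -[x y] /=; tauto.
apply: bisuslinI; last exact: bisuslinT.
have : (@ocitv R).-sigma.-measurable B by [].
rewrite measurable_realfun.RGenCInfty.measurableE => {mB}.
suff : @measurable_realfun.RGenCInfty.G R `<=` [set B | bisuslin (B `*` setT)].
  move=> GB; move: B; apply: smallest_sub => //; split => /=.
  - by rewrite set0X; exact: bisuslin0.
  - move=> B /bisuslinC; rewrite setTD (_ : ~` (_ `*` _) = (~` B) `*` setT) //.
    by apply/seteqP; split => -[x y] /=; tauto.
  - move=> B /bisuslin_bigcup; rewrite (_ : \bigcup_i (B i `*` _) = (\bigcup_i B i) `*` setT) //.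
    apply/seteqP; split => -[x y] /=; first by move=> [i _ []]; split => //; exists i.
    by move=> [[i _ ?] _]; exists i.
by move=> _ [x ->]; exact: bisuslin_ray.
Qed.

End projection.

(** * Capacitability of projections *)

Section capacity.
Context (R : realType) (d : measure_display) (S : measurableType d).
Variable mu : probability S R.

(** Amounts to outer measure at most e, since the infimum over measurable hulls is attained by a
    countable intersection. *)
Definition outer_le (e : R) (E : set S) : Prop :=
  exists G, [/\ measurable G, E `<=` G & (mu G <= e%:E)%E].

Lemma outer_le_bigcup e (E : nat -> set S) :
  (forall i j, (i <= j)%N -> E i `<=` E j) ->
  (forall i, outer_le e (E i)) -> outer_le e (\bigcup_i E i).
Proof.
move=> Emon /choice[G EG].
(* The inferior limit of the hulls G j is a hull of the union. *)
pose H i := \bigcap_(j in [set j | (i <= j)%N]) G j.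
have mG j : measurable (G j) by case: (EG j).
have mH i : measurable (H i).
  by apply: bigcap_measurable => [|j _]; [exists i => /=|exact: mG].
exists (\bigcup_i H i); split.
- exact: bigcupT_measurable.
- move=> w [i _ Eiw]; exists i => // j /= ij; have [_ EGj _] := EG j.
  by apply: EGj; exact: Emon ij _ Eiw.
- have Hmon : {homo H : n m / (n <= m)%N >-> (n <= m)%O}.
    move=> i j ij; apply/subsetPset => w Hw k /= jk; apply: Hw => /=.
    exact: leq_trans jk.
  have := @nondecreasing_cvg_mu _ _ _ mu H mH (bigcupT_measurable _ mH) Hmon.
  move=> cv; rewrite -(cvg_lim _ cv)//; apply: lime_le; first by apply/cvg_ex; eexists; exact: cv.
  apply: nearW => i /=; have [_ _] := EG i; apply: le_trans.
  by apply: le_measure; rewrite ?inE //; apply: bigcap_inf => /=.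
Qed.

(** Choquet's capacitability argument. If the projection had outer measure above e, continuity along
    increasing unions would bound the indices one at a time while keeping the outer measure above e.
    The part with bounded indices then yields a measurable subset of measure at least e, against the
    assumption on G. *)
Lemma suslin_capacity (K : set R) (A : set (R * S)) : compact K -> suslin A ->
  (forall G, measurable G -> G `<=` snd @` (A `&` (K `*` setT)) -> mu G = 0%E) ->
  mu.-negligible (snd @` (A `&` (K `*` setT))).
Proof.
move=> cK [Q [QE Qrect AE]] Anull.
set B := snd @` _ in Anull *.
(* Points reached with the first indices bounded by s and the later ones free. *)
pose E (s : seq nat) := [set w | exists t u, [/\ K t,
  forall i, (i < size s)%N -> (u i <= nth 0 s i)%N & forall m, Q m u (t, w)]].
have BE : B = E [::].
  rewrite /B AE; apply/seteqP; split => w /=.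
    by move=> [[t w'] [[u Qu] [Kt _]] /= <-]; exists t, u; split.
  by move=> [t [u [Kt _ Qu]]]; exists (t, w) => //; split => //; exists u.
have ES s : E s = \bigcup_v E (rcons s v).
  apply/seteqP; split => w /=.
    move=> [t [u [Kt us Qu]]]; exists (u (size s)) => //; exists t, u; split => //.
    move=> i; rewrite size_rcons ltnS leq_eqVlt nth_rcons => /predU1P[->|lis].
      by rewrite ltnn eqxx.
    by rewrite lis us.
  move=> [v _ [t [u [Kt us Qu]]]]; exists t, u; split => // i lis.
  have := us i; rewrite size_rcons nth_rcons lis; apply.
  exact: ltnW.
suff sB e : 0 < e -> outer_le e B.
  have /choice[G GP] n : exists G, [/\ measurable G, B `<=` G & (mu G <= n.+1%:R^-1%:E)%E].
    by apply: sB; rewrite invr_gt0.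
  have mG n : measurable (G n) by case: (GP n).
  have mGG : measurable (\bigcap_n G n) by exact: bigcapT_measurable.
  exists (\bigcap_n G n); split => //; last by move=> w Bw n _; case: (GP n) => _ + _; exact.
  apply/eqP; rewrite eq_le measure_ge0 andbT; apply/lee_addgt0Pr => e e0.
  rewrite add0e; pose n := Num.truncn e^-1.
  have [_ _] := GP n => Gn; apply: (@le_trans _ _ (mu (G n))).
    by apply: le_measure; rewrite ?inE //; exact: bigcap_inf.
  apply: le_trans Gn _; rewrite lee_fin invf_ple ?posrE //.
  exact/ltW/truncnS_gt.
move=> e0; apply: contrapT; rewrite BE => nE.
(* The scheme is cut down to indices bounded by b without the projection dropping to outer
   measure at most e. *)
have [] := @seq_choice (fun s => ~ outer_le e (E s)) nE.
  move=> s nEs; apply: contrapT => nv; apply: nEs; rewrite ES.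
  apply: outer_le_bigcup.
    move=> i j ij w /= [t [u [Kt us Qu]]]; exists t, u; split => // k.
    rewrite size_rcons => ks; have := us k; rewrite size_rcons => /(_ ks).
    rewrite !nth_rcons.
    case: ltngtP => // _ uk; exact: leq_trans uk ij.
  by move=> v; apply: contrapT => nEv; apply: nv; exists v.
move=> b nEb.
pose L n := [set w | exists t u, [/\ K t, forall i, (u i <= b i)%N
  & forall m, (m < n)%N -> Q m u (t, w)]].
have EL n : E (mkseq b n) `<=` L n.
  move=> w [t [u [Kt ub Qu]]]; exists t, (fun i => if (i < n)%N then u i else 0%N).
  split => //.
    move=> i; case: ifPn => // lin.
    by have := ub i; rewrite size_mkseq nth_mkseq //; exact.
  move=> m mn; rewrite (QE _ _ u) // => i im.
  by rewrite (ltn_trans im mn).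
(* Levels below n read only the first n indices, so finite sequences padded with 0 suffice, and
   these are countably many. For each, either the closed time factors share a point of K, which
   leaves an intersection of measurable factors, or nothing remains. *)
have mL n : measurable (L n).
  have -> : L n = \bigcup_(s : seq nat) [set w | (forall i, (nth 0 s i <= b i)%N) /\
      exists t, K t /\ forall m, (m < n)%N -> Q m (nth 0%N s) (t, w)].
    apply/seteqP; split => w /=.
      move=> [t [u [Kt ub Qu]]]; exists (mkseq u n) => //; split.
        move=> i; case: (ltnP i n) => lin; first by rewrite nth_mkseq.
        by rewrite nth_default // size_mkseq.
      exists t; split => // m mn; rewrite (QE _ _ u); first exact: Qu.
      by move=> i im; rewrite nth_mkseq //; exact: ltn_trans mn.
    by move=> [s _ [sb [t [Kt Qs]]]]; exists t, (nth 0%N s).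
  apply: countable_bigcupT_measurable; first exact: countableP.
  move=> s; have [sb|nsb] := pselect (forall i, (nth 0 s i <= b i)%N); last first.
    by rewrite (_ : mkset _ = set0) //; apply/seteqP; split => w //= [].
  have /choice[CF CFE] m : exists CF : set R * set S, [/\ closed CF.1, measurable CF.2
      & Q m (nth 0%N s) = CF.1 `*` CF.2].
    by have [C [F ?]] := Qrect m (nth 0%N s); exists (C, F).
  have [[t [Kt Ct]]|nt] := pselect (exists t, K t /\ forall m, (m < n)%N -> (CF m).1 t).
    rewrite (_ : mkset _ = \bigcap_(m in [set m | (m < n)%N]) (CF m).2).
      by apply: bigcap_measurableType => m _; case: (CFE m).
    apply/seteqP; split => w /=.
      by move=> [_ [t' [_ Qt]]] m /= mn; have := Qt _ mn; case: (CFE m) => _ _ -> [].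
    move=> CFw; split=> //; exists t; split => // m mn.
    by case: (CFE m) => _ _ ->; split; [exact: Ct|exact: CFw].
  rewrite (_ : mkset _ = set0) //; apply/seteqP; split => w //= [_ [t [Kt Qt]]].
  by apply: nt; exists t; split => // m mn; have := Qt _ mn; case: (CFE m) => _ _ -> [].
(* Koenig lemma for the indices and compactness of K for the times. *)
have LB : \bigcap_n L n `<=` B.
  move=> w Lw.
  have [] := @seq_choice (fun s => forall n, exists t u, [/\ K t, forall i, (u i <= b i)%N,
      forall i, (i < size s)%N -> u i = nth 0%N s i & forall m, (m < n)%N -> Q m u (t, w)]).
  - by move=> n; have [t [u [Kt ub Qu]]] := Lw n Logic.I; exists t, u; split.
  - move=> s sP; apply: contrapT => /forallNP nv.
    have /choice[N NP] v := (existsNP _).2 (nv v).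
    (* If each of the finitely many candidates v failed at some depth N v, a branch valid up to the
       maximal depth would contradict this for its own next index. *)
    have [t [u [Kt ub us Qu]]] := sP (\max_(v < (b (size s)).+1) N v).
    apply: (NP (u (size s))); exists t, u; split => //.
      move=> i; rewrite size_rcons ltnS leq_eqVlt nth_rcons => /predU1P[->|lis].
        by rewrite ltnn eqxx.
      by rewrite lis us.
    move=> m mN; apply: Qu; apply: (leq_trans mN).
    have ul : (u (size s) < (b (size s)).+1)%N by rewrite ltnS.
    exact: (@leq_bigmax_cond _ _ (fun v : 'I_(b (size s)).+1 => N v) (Ordinal ul)).
  move=> s sP.
  have Qs n : exists t, K t /\ forall m, (m < n)%N -> Q m s (t, w).
    have [t [u [Kt ub us Qu]]] := sP n n; exists t; split => // m mn.
    rewrite (QE _ _ u); first exact: Qu.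
    move=> i im; have lin := ltn_trans im mn.
    by rewrite us ?size_mkseq // nth_mkseq.
  have := cK; rewrite compact_In0 => /(_ nat setT (fun m => K `&` [set t | Q m s (t, w)])) [].
  - exists (fun m => [set t | Q m s (t, w)]) => // m _.
    have [C [F [cC _ ->]]] := Qrect m s.
    have [Fw|nFw] := pselect (F w).
      by rewrite (_ : mkset _ = C) //; apply/seteqP; split => t //= [].
    by rewrite (_ : mkset _ = set0) //; [exact: closed0|apply/seteqP; split => t //= []].
  - move=> D _; have [t [Kt Qt]] := Qs (\max_(i <- finmap.enum_fset D) i).+1.
    exists t => m /= mD; split => //; apply: Qt.
    by rewrite ltnS; exact: leq_bigmax_seq.
  move=> t tP; rewrite BE; exists t, s; split => //; first by case: (tP 0%N Logic.I).
  by move=> m; case: (tP m Logic.I).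
have Lmon : {homo L : n m / (n <= m)%N >-> (m <= n)%O}.
  move=> n m nm; apply/subsetPset => w [t [u [Kt ub Qu]]]; exists t, u; split => // k kn.
  by apply: Qu; exact: leq_trans nm.
have mLL : measurable (\bigcap_n L n) by exact: bigcapT_measurable.
have L0 : (mu (L 0%N) < +oo)%E.
  by rewrite -ge0_fin_numE; [exact: fin_num_measure|exact: measure_ge0].
have cv := @nonincreasing_cvg_mu _ _ _ mu L L0 mL mLL Lmon.
have := Anull _ mLL LB; rewrite -(cvg_lim _ cv) // => lim0.
have : (e%:E <= lim (mu \o L @ \oo))%E.
  apply: lime_ge; first by apply/cvg_ex; eexists; exact: cv.
  apply: nearW => n /=; rewrite leNgt; apply/negP => /ltW Le; apply: (nEb n).
  by exists (L n).
by rewrite lim0 lee_fin leNgt e0.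
Qed.

Theorem measurable_projection (A : set (R * S)) : measurable A ->
  (forall G, measurable G -> G `<=` snd @` A -> mu G = 0%E) ->
  mu.-negligible (snd @` A).
Proof.
move=> mA Anull.
rewrite (_ : snd @` A = \bigcup_n (snd @` (A `&` (`[- n%:R, n%:R] `*` setT)))).
  apply: negligible_bigcup => n; apply: suslin_capacity.
  - exact: segment_compact.
  - exact: measurable_suslin.
  - move=> G mG GA; apply: Anull => // w /GA[x [Ax _] <-]; by exists x.
apply/seteqP; split => w /=; last by move=> [n _ [x [Ax _] <-]]; exists x.
move=> [[t w'] Ax /= <-]; exists (Num.truncn `|t|).+1 => //.
exists (t, w') => //; split => //; split => //=.
by rewrite in_itv /= -ler_norml; exact/ltW/truncnS_gt.
Qed.

End capacity.

(** * Measurability of right-continuous processes *)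

Lemma open_borel (R : realType) (n : nat) (U : set 'rV[R]_n) : open U -> borel U.
Proof. by move=> oU; apply: sub_sigma_algebra. Qed.

Lemma measurable_coord (R : realType) (n : nat) (i : 'I_n) :
  measurable_fun setT (fun v : Rn R n => v ord0 i).
Proof.
apply: (measurability _ (measurable_realfun.RGenOInfty.measurableE R)).
move=> _ [_ [x ->] <-]; rewrite setTI; apply: open_borel.
apply: open_comp; last exact: rray_open.
by move=> v _; exact: coord_continuous.
Qed.

(** Rational centres and radii 1/(k+1) give a countable base. Balls of row vectors are boxes, so
    measurability into [Rn] reduces to the coordinates. *)
Lemma open_bigcup_ball (R : realType) (n : nat) (U : set 'rV[R]_n) : open U ->
  U = \bigcup_(p in [set p : 'rV[rat]_n * nat |
        ball (map_mx ratr p.1 : 'rV[R]_n) p.2.+1%:R^-1 `<=` U])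
      ball (map_mx ratr p.1 : 'rV[R]_n) p.2.+1%:R^-1.
Proof.
move=> oU; apply/seteqP; split => [v Uv|v [p /= pU]]; last exact: pU.
have /nbhs_ballP[e /= e0 eU] : nbhs v U by exact: open_nbhs_nbhs.
pose k := Num.truncn (2 / e).
have k0 : 0 < k.+1%:R^-1 :> R by rewrite invr_gt0.
have k2 : k.+1%:R^-1 + k.+1%:R^-1 < e.
  rewrite -mulr2n -[_ *+ 2]mulr_natr -ltr_pdivlMr // -[e / 2]invrK invf_div.
  by rewrite ltf_pV2 ?posrE ?divr_gt0 // truncnS_gt.
have /choice[c cP] i : exists c : rat, `|v ord0 i - ratr c| < k.+1%:R^-1.
  have [|c] := @rat_in_itvoo R (v ord0 i - k.+1%:R^-1) (v ord0 i + k.+1%:R^-1).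
    by rewrite ltrD2l (lt_trans _ k0) // oppr_lt0.
  rewrite in_itv /= => cv; exists c; by rewrite distrC ltr_distl.
have bv : ball (map_mx ratr (\row_i c i) : 'rV[R]_n) k.+1%:R^-1 v.
  split => // i j; rewrite !mxE (ord1 i); have := cP j.
  by rewrite -ball_normE /= distrC.
exists (\row_i c i, k) => //= w bw; apply: eU.
by apply: (le_ball (ltW k2)); apply: ball_triangle bw; exact: ball_sym.
Qed.

Lemma measurable_fun_Rn d (T : measurableType d) (R : realType) (n : nat)
    (f : T -> 'rV[R]_n) :
  (forall i, measurable_fun setT (fun w => f w ord0 i)) ->
  measurable_fun setT (f : T -> Rn R n).
Proof.
move=> mf; apply: (@measurability _ _ _ (Rn R n) setT f (@open 'rV[R]_n)) => //.
move=> _ [U oU <-]; rewrite setTI (open_bigcup_ball oU) preimage_bigcup bigcup_mkcond.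
apply: countable_bigcupT_measurable; first exact: countableP.
move=> [c k]; case: ifPn => // _ /=.
rewrite (_ : _ @^-1` _ = \bigcap_(i in [set: 'I_n])
  ((fun w => f w ord0 i) @^-1` ball (ratr (c ord0 i) : R) k.+1%:R^-1)).
  apply: fin_bigcap_measurable => // i _; rewrite -[_ @^-1` _]setTI; apply: mf => //.
  exact: measurable_ball.
apply/seteqP; split => w /=.
  by move=> [_ bw] i _ /=; have := bw ord0 i; rewrite mxE.
move=> bw; split => [|i j]; first by rewrite invr_gt0.
by rewrite mxE ord1; exact: bw.
Qed.

Lemma measurable_fun_RnD d (T : measurableType d) (R : realType) (n : nat)
    (f g : T -> Rn R n) : measurable_fun setT f -> measurable_fun setT g ->
  measurable_fun setT (fun w => f w + g w : Rn R n).
Proof.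
move=> mf mg; apply: measurable_fun_Rn => i.
rewrite (_ : (fun w => _) = (fun w => f w ord0 i) \+ (fun w => g w ord0 i)).
  by apply: measurable_funD; apply: (measurableT_comp (measurable_coord i)).
by apply/funext => w; rewrite mxE.
Qed.

Lemma measurable_fun_RnB d (T : measurableType d) (R : realType) (n : nat)
    (f g : T -> Rn R n) : measurable_fun setT f -> measurable_fun setT g ->
  measurable_fun setT (fun w => f w - g w : Rn R n).
Proof.
move=> mf mg; apply: measurable_fun_Rn => i.
rewrite (_ : (fun w => _) = (fun w => f w ord0 i) \- (fun w => g w ord0 i)).
  by apply: measurable_funB; apply: (measurableT_comp (measurable_coord i)).
by apply/funext => w; rewrite !mxE.
Qed.

Lemma borel_set1 (R : realType) (n : nat) (v : 'rV[R]_n) : borel [set v].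
Proof.
rewrite /borel -[X in measurable X]setCK; apply: measurableC.
apply: open_borel; rewrite openC.
exact/accessible_closed_set1/hausdorff_accessible/norm_hausdorff.
Qed.

Definition dyadic (R : realType) (m j : nat) : R := j%:R / (2 ^ m)%:R.

Section regularization.
Context (R : realType) (n : nat) (d : measure_display) (S : measurableType d).
Variable X : R -> S -> 'rV[R]_n.

(** Strictly above t even when t lies on the grid, so that t is approached from the right only, the
    side on which cadlag paths are continuous. *)
Definition dyadic_succ (m : nat) (t : R) : R :=
  dyadic R m (Num.truncn (t * (2 ^ m)%:R)).+1.

(* The superior limit makes this jointly measurable for arbitrary paths, with junk values at
   times where the path is not right-continuous. *)
Definition right_reg (p : R * S) : 'rV[R]_n :=
  \row_i fine (limn_esup (fun m => (X (dyadic_succ m p.1) p.2 ord0 i)%:E)).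

Lemma measurable_truncn (a : R) (k : nat) :
  measurable [set t : R | Num.truncn (t * a) = k].
Proof.
have mlt j : measurable [set t : R | (Num.truncn (t * a) <= j)%N].
  rewrite (_ : mkset _ = (fun t => t * a) @^-1` `]-oo, j.+1%:R[%classic).
    rewrite -[_ @^-1` _]setTI; have : measurable_fun [set: R] (fun t => t * a).
      exact: measurable_funM.
    by apply => //; exact: measurable_itv.
  by apply/seteqP; split => t /=; rewrite in_itv /= truncn_le_nat.
rewrite (_ : mkset _ = [set t : R | (Num.truncn (t * a) <= k)%N] `\`
   (if k is j.+1 then [set t : R | (Num.truncn (t * a) <= j)%N] else set0)).
  by apply: measurableD => //; case: k => //.
case: k => [|k]; apply/seteqP; split => t /=.
- by move=> ->; split.
- by move=> [+ _]; rewrite leqn0 => /eqP.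
- by move=> ->; rewrite ltnn.
- by move=> [? /negP]; rewrite -ltnNge => ?; apply/eqP; rewrite eqn_leq; apply/andP.
Qed.

Lemma dyadic_ge0 m j : 0 <= dyadic R m j.
Proof. by rewrite divr_ge0. Qed.

Lemma measurable_right_reg :
  (forall t, 0 <= t -> measurable_fun setT (X t : S -> Rn R n)) ->
  measurable_fun setT (right_reg : R * S -> Rn R n).
Proof.
move=> mX; apply: measurable_fun_Rn => i.
rewrite (_ : (fun w => _) =
    fine \o (fun p => limn_esup (fun m => (X (dyadic_succ m p.1) p.2 ord0 i)%:E))).
  apply: measurableT_comp => //.
  apply: measurable_fun_limn_esup => m; apply/measurable_EFinP.
  move=> _ B mB; rewrite setTI.
  rewrite (_ : _ @^-1` B = \bigcup_j ([set t : R | Num.truncn (t * (2 ^ m)%:R) = j] `*`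
      ((fun w => X (dyadic R m j.+1) w ord0 i) @^-1` B))).
    apply: bigcupT_measurable => j; apply: measurableX; first exact: measurable_truncn.
    rewrite -[_ @^-1` _]setTI.
    exact: (measurableT_comp (measurable_coord i) (mX _ (dyadic_ge0 m j.+1))).
  apply/seteqP; split => -[t w] /=.
    by move=> Bt; exists (Num.truncn (t * (2 ^ m)%:R)).
  by move=> [j _ [/= <-]].
by apply/funext => w /=; rewrite mxE.
Qed.

Lemma dyadic_succ_gt m (t : R) : t < dyadic_succ m t.
Proof. by rewrite ltr_pdivlMr ?ltr0n ?expn_gt0 // truncnS_gt. Qed.

Lemma dyadic_succ_le m (t : R) : 0 <= t -> dyadic_succ m t <= t + (2 ^ m)%:R^-1.
Proof.
move=> t0; rewrite ler_pdivrMr ?ltr0n ?expn_gt0 // mulrDl mulVf ?pnatr_eq0 ?expn_eq0 //.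
by rewrite -natr1 lerD2r truncn_le mulr_ge0.
Qed.

Lemma cvg_inv2X : ((2 ^ m)%:R^-1 : R) @[m --> \oo] --> 0.
Proof.
have := @cvg_geometric R 1 2^-1; rewrite ger0_norm ?invr_ge0 // invf_lt1 // ltr1n => /(_ isT).
by apply: cvg_trans; apply: near_eq_cvg; apply: nearW => m; rewrite /= mul1r exprVn natrX.
Qed.

Lemma cvg_dyadic_succ (t : R) : 0 <= t -> dyadic_succ m t @[m --> \oo] --> t.
Proof.
move=> t0; apply: (@squeeze_cvgr _ _ _ _ (cst t) (fun m => t + (2 ^ m)%:R^-1)).
- by apply: nearW => m; rewrite (ltW (dyadic_succ_gt _ _)) dyadic_succ_le.
- exact: cvg_cst.
- by rewrite -[X in _ --> X]addr0; apply: cvgD; [exact: cvg_cst|exact: cvg_inv2X].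
Qed.

Lemma dyadic_succ_at_right (t : R) : 0 <= t -> dyadic_succ m t @[m --> \oo] --> t^'+.
Proof.
move=> t0 A tA; have [N _ NA] := cvg_dyadic_succ t0 tA.
by exists N => // m Nm; apply: NA => //; exact: dyadic_succ_gt.
Qed.

Lemma cvg_dyadic_right (g : R -> 'rV[R]_n) (t : R) : 0 <= t ->
  g s @[s --> t^'+] --> g t -> g (dyadic_succ m t) @[m --> \oo] --> g t.
Proof. by move=> t0; apply: cvg_comp; exact: dyadic_succ_at_right. Qed.

Lemma right_regE t w : 0 <= t -> X s w @[s --> t^'+] --> X t w ->
  right_reg (t, w) = X t w.
Proof.
move=> t0 Xt; apply/rowP => i; rewrite mxE /=.
have cv : X (dyadic_succ m t) w ord0 i @[m --> \oo] --> X t w ord0 i.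
  have := @continuous_cvg _ _ _ _ _ _ (fun M : 'rV[R]_n => M ord0 i) (X t w) _
    (cvg_dyadic_right (g := X ^~ w) t0 Xt).
  by apply; apply: coord_continuous.
have ecv : (X (dyadic_succ m t) w ord0 i)%:E @[m --> \oo] --> (X t w ord0 i)%:E.
  by apply: cvg_EFin; [exact: nearW|exact: cv].
rewrite is_cvg_limn_esupE; first by rewrite (cvg_lim _ ecv).
by apply/cvg_ex; exists (X t w ord0 i)%:E.
Qed.

End regularization.

(** * Hitting events *)

Definition law d d' (T : measurableType d) (T' : measurableType d') (R : realType)
    (P : probability T R) (f : T -> T') (mf : measurable_fun setT f) : probability T' R :=
  distribution P (mfun_Sub (mem_set mf)).

Section hitting.
Context (d : measure_display) (T : measurableType d) (R : realType).
Variables (P : probability T R) (n : nat) (X : R -> T -> 'rV[R]_n).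
Hypothesis mX : forall t, 0 <= t -> measurable_fun setT (X t : T -> Rn R n).
Hypothesis cX : {ae P, forall w, cadlag (fun t => X t w)}.

Definition process_gen : set (set T) :=
  [set A | exists t B, [/\ 0 <= t, borel B & A = X t @^-1` B]].

Notation TX := (g_sigma_algebraType process_gen).

Lemma process_sigma_measurable (A : set T) : process_sigma X A -> measurable A.
Proof.
move: A; apply: smallest_sub; first exact: sigma_algebra_measurable.
move=> _ [t [B [t0 mB ->]]]; rewrite -[_ @^-1` _]setTI; exact: mX.
Qed.

Lemma measurable_id_process : measurable_fun setT (id : T -> TX).
Proof. by move=> _ A mA; rewrite setTI; exact: process_sigma_measurable. Qed.

Definition process_prob : probability TX R := law P measurable_id_process.

Lemma measurable_process t : 0 <= t -> measurable_fun setT (X t : TX -> Rn R n).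
Proof.
move=> t0 _ B mB; rewrite setTI; apply: sub_sigma_algebra.
by exists t, B.
Qed.

Lemma measurable_prod_process (G : set (Rn R n * TX)) : measurable G ->
  measurable (G : set (Rn R n * T)).
Proof.
move=> mG; rewrite (_ : G = (fun xw : Rn R n * T => (xw.1, id xw.2 : TX)) @^-1` G).
  rewrite -[_ @^-1` _]setTI.
  have mf : measurable_fun setT (fun xw : Rn R n * T => (xw.1, id xw.2 : TX)).
    apply: measurable_fun_pair => //.
    exact: (measurableT_comp measurable_id_process measurable_snd).
  exact: mf.
by apply/seteqP; split => -[].
Qed.

Definition hits (I : set R) (D : set 'rV[R]_n) : set (Rn R n * T) :=
  [set xw | exists t, I t /\ D (xw.1 + X t xw.2)].

Let good : set (Rn R n * T) := [set xw | cadlag (fun t => X t xw.2)].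

Lemma negligible_snd (nu : probability (Rn R n) R) (N : set T) :
  P.-negligible N -> (nu \x P)%E.-negligible [set xw : Rn R n * T | N xw.2].
Proof.
move=> [M [mM M0 NM]]; exists (setT `*` M); split.
- exact: measurableX.
- by apply: (etrans (product_measure1E _ _ _ _)) => //; rewrite [X in (_ * X)%E]M0 mule0.
- by move=> xw /= /NM.
Qed.

Let hits_projection (nu : probability (Rn R n) R) (I : set R) (D : set 'rV[R]_n) :
  measurable I -> (forall t, I t -> 0 <= t) -> borel D ->
  (forall G : set (Rn R n * TX), measurable G ->
    G `&` good `<=` hits I D -> (nu \x process_prob)%E G = 0%E) ->
  exists N : set (Rn R n * TX),
    [/\ measurable N, (nu \x process_prob)%E N = 0%E & hits I D `&` good `<=` N].
Proof.
move=> mI I0 mD Gnull.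
pose A := [set p : R * (Rn R n * TX) | I p.1 /\
  D ((p.2.1 : 'rV[R]_n) + right_reg X (p.1, p.2.2))].
have mA : measurable A.
  have mF : measurable_fun setT (fun p : R * (Rn R n * TX) =>
      (p.2.1 : Rn R n) + (right_reg X (p.1, p.2.2 : T) : Rn R n) : Rn R n).
    apply: measurable_fun_RnD; first exact: (measurableT_comp measurable_fst measurable_snd).
    apply: (measurableT_comp (measurable_right_reg (S := TX) measurable_process)).
    apply: measurable_fun_pair => //.
    exact: (measurableT_comp measurable_snd measurable_snd).
  rewrite (_ : A = (fst @^-1` I) `&` ((fun p : R * (Rn R n * TX) =>
      (p.2.1 : Rn R n) + (right_reg X (p.1, p.2.2 : T) : Rn R n) : Rn R n) @^-1` D)) //.
  apply: measurableI; rewrite -[_ @^-1` _]setTI; [exact: measurable_fst|exact: mF].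
have hA : hits I D `&` good = (snd @` A) `&` good.
  apply/seteqP; split => -[y w] /= [].
    move=> [t [It Dt]] gw; split => //; exists (t, (y, w)) => //; split => //=.
    by rewrite right_regE ?I0 //; apply: gw.1; exact: I0.
  move=> [[t [y' w']] [/= It Dt] [<- <-]] gw; split => //; exists t; split => //=.
  by move: Dt; rewrite right_regE ?I0 //; apply: gw.1; exact: I0.
have [N [mN N0 AN]] : (nu \x process_prob)%E.-negligible (snd @` A).
  apply: measurable_projection => // G mG GA.
  apply: Gnull => //; apply: (@subset_trans _ (snd @` A `&` good)); first exact: setSI.
  by rewrite -hA; exact: subIsetl.
exists N; split => //; rewrite hA.
by apply: subset_trans AN.
Qed.

Lemma xsection_process (G : set (Rn R n * TX)) (y : Rn R n) :
  measurable G -> process_sigma X (xsection G y).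
Proof. by move=> mG; exact: (@measurable_xsection _ _ (Rn R n) TX). Qed.

(** Nullity on E alone suffices: the sections of a measurable G under the event belong to the
    sigma-algebra of X, so intersecting them with E multiplies their probability by P E, and Fubini
    shows that the measure of G times P E is 0. *)
Lemma hits_cover_indep (nu : probability (Rn R n) R) (I : set R) (D : set 'rV[R]_n)
    (E : set T) : measurable I -> (forall t, I t -> 0 <= t) -> borel D ->
  measurable E -> (forall A, process_sigma X A -> P (A `&` E) = (P A * P E)%E) ->
  P E != 0%E ->
  (nu \x P)%E.-negligible (hits I D `&` (setT `*` E)) ->
  exists N : set (Rn R n * TX),
    [/\ measurable N, (nu \x process_prob)%E N = 0%E & hits I D `&` good `<=` N].
Proof.
move=> mI I0 mD mE indE E0 hN; apply: hits_projection => // G mG Gh.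
have mG' := measurable_prod_process mG.
have GE0 : (nu \x P)%E (G `&` (setT `*` E)) = 0%E.
  apply: measure_negligible; first by apply: measurableI => //; exact: measurableX.
  apply: negligibleS (negligibleU hN (negligible_snd nu cX)).
  move=> [y w] [Gyw [_ /= Ew]].
  have [gw|gw] := pselect (good (y, w)); last by right.
  by left; split => //; apply: Gh.
have : ((nu \x process_prob) G * P E = 0)%E.
  rewrite -GE0 /product_measure1 -ge0_integralZr //=.
  - apply: eq_integral => y _ /=; rewrite -indE; last exact: xsection_process.
    congr (P _); apply/seteqP; split => w /=; rewrite /xsection /= !inE /=.
      by move=> [].
    by move=> [? []].
  - exact: (@measurable_fun_xsection _ _ (Rn R n) TX R process_prob G mG).
by move=> /eqP; rewrite mule_eq0 (negbTE E0) orbF => /eqP.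
Qed.

Lemma hits_cover (nu : probability (Rn R n) R) (I : set R) (D : set 'rV[R]_n) :
  measurable I -> (forall t, I t -> 0 <= t) -> borel D ->
  (nu \x P)%E.-negligible (hits I D) ->
  exists N : set (Rn R n * TX),
    [/\ measurable N, (nu \x process_prob)%E N = 0%E & hits I D `&` good `<=` N].
Proof.
move=> mI I0 mD hN; apply: (@hits_cover_indep nu I D setT) => //.
- by move=> A _; rewrite setIT probability_setT mule1.
- by rewrite probability_setT onee_neq0.
- by apply: negligibleS hN => ? [].
Qed.

(** Polarity is given one starting point at a time, with exceptional sets that need not depend
    measurably on y; Fubini is applied only to measurable subsets of the event. *)
Lemma hits_cover_pointwise (nu : probability (Rn R n) R) (I : set R) (D : set 'rV[R]_n) :
  measurable I -> (forall t, I t -> 0 <= t) -> borel D ->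
  (forall y, P.-negligible [set w | hits I D (y, w)]) ->
  exists N : set (Rn R n * TX),
    [/\ measurable N, (nu \x process_prob)%E N = 0%E & hits I D `&` good `<=` N].
Proof.
move=> mI I0 mD hN; apply: hits_projection => // G mG Gh.
rewrite /product_measure1 integral0_eq // => y _ /=.
have mGy := process_sigma_measurable (xsection_process y mG).
apply: (measure_negligible (mu := P)) => //.
apply: negligibleS (negligibleU (hN y) cX) => w; rewrite /xsection /= inE => Gyw.
have [gw|gw] := pselect (good (y, w)); last by right.
by left; apply: Gh.
Qed.

Lemma negligible_cover (nu : probability (Rn R n) R) (N : set (Rn R n * TX))
    (H : set (Rn R n * T)) : measurable N -> (nu \x process_prob)%E N = 0%E ->
  H `&` good `<=` N -> (nu \x P)%E.-negligible H.
Proof.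
move=> mN N0 HN.
have nN : (nu \x P)%E.-negligible (N : set (Rn R n * T)).
  by exists N; split => //; exact: measurable_prod_process.
apply: negligibleS (negligibleU nN (negligible_snd nu cX)) => xw Hxw.
by have [gw|gw] := pselect (good xw); [left; exact: HN|right].
Qed.

(** * Translation of the starting point by an independent vector *)

Section shift.
Variable Y : T -> 'rV[R]_n.
Hypothesis mY : measurable_fun setT (Y : T -> Rn R n).
Hypothesis indY : forall A B, process_sigma X A -> borel B ->
  P (A `&` Y @^-1` B) = (P A * P (Y @^-1` B))%E.

Lemma measurable_shift :
  measurable_fun setT (fun xw : Rn R n * T => (xw.1 : 'rV[R]_n) + Y xw.2 : Rn R n).
Proof.
apply: measurable_fun_RnD => //.
exact: (measurableT_comp mY measurable_snd).
Qed.

(** The convolution of nu with the law of Y. *)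
Definition shift_law (nu : probability (Rn R n) R) : probability (Rn R n) R :=
  law (nu \x P)%E measurable_shift.

(** Since Y is independent of the sigma-algebra of X, the map (x, w) |-> (x + Y w, w) into R^n times
    [TX] carries nu x P to the product measure of the claim: both agree on rectangles. *)
Lemma shift_law_null (nu : probability (Rn R n) R) (N : set (Rn R n * TX)) :
  measurable N -> (shift_law nu \x process_prob)%E N = 0%E ->
  (nu \x P)%E.-negligible
    [set xw : Rn R n * T | N ((xw.1 : 'rV[R]_n) + Y xw.2, xw.2)].
Proof.
move=> mN N0.
have mf : measurable_fun setT (fun xw : Rn R n * T =>
    ((xw.1 : 'rV[R]_n) + Y xw.2 : Rn R n, xw.2 : TX)).
  apply: measurable_fun_pair; first exact: measurable_shift.
  exact: (measurableT_comp measurable_id_process measurable_snd).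
apply/negligibleP; first by rewrite -[X in measurable X]setTI; exact: mf.
rewrite -[LHS]/(law (nu \x P)%E mf N) -N0; apply/esym.
apply: product_measure_unique => // A B mA mB.
pose AY := [set xw : Rn R n * T | A ((xw.1 : 'rV[R]_n) + Y xw.2)].
change ((nu \x P) (AY `&` [set xw | B xw.2]) = (nu \x P) AY * P B)%E.
have mB' : measurable (B : set T) by exact: process_sigma_measurable.
have mshift : measurable AY.
  by rewrite -[X in measurable X]setTI; exact: measurable_shift.
rewrite /= /product_measure1 -ge0_integralZr //=.
- apply: eq_integral => y _ /=.
  pose A' := (fun v : Rn R n => (y : 'rV[R]_n) + (v : 'rV[R]_n) : Rn R n) @^-1` A.
  have mA' : borel A'.
    rewrite /borel -[A']setTI.
    have mD : measurable_fun setT (fun v : Rn R n => (y : 'rV[R]_n) + (v : 'rV[R]_n) : Rn R n).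
      by apply: measurable_fun_RnD => //; exact: measurable_cst.
    exact: mD.
  have -> : xsection AY y =
      Y @^-1` A'.
    by apply/seteqP; split => w; rewrite /xsection /= inE.
  rewrite muleC -indY //; congr (P _).
  apply/seteqP; split => w; rewrite /xsection /= inE /=; [by move=> []|by move=> []].
- exact: measurable_fun_xsection.
Qed.

Lemma negligible_shift (nu : probability (Rn R n) R) (N : set (Rn R n * TX))
    (H : set (Rn R n * T)) :
  measurable N -> (shift_law nu \x process_prob)%E N = 0%E -> H `&` good `<=` N ->
  (nu \x P)%E.-negligible
    [set xw : Rn R n * T | H ((xw.1 : 'rV[R]_n) + Y xw.2, xw.2)].
Proof.
move=> mN N0 HN.
apply: negligibleS (negligibleU (shift_law_null mN N0) (negligible_snd nu cX)).
move=> xw Hxw; have [gw|gw] := pselect (cadlag (fun t => X t xw.2)); last by right.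
by left; apply: HN.
Qed.

End shift.
End hitting.

(** * Small-time behaviour of compound Poisson processes *)

Lemma cos_ge1B_norm (R : realType) (v : R) : 1 - `|v| <= cos v.
Proof.
wlog v0 : v / 0 <= v.
  move=> h; have [|/ltW v0] := leP 0 v; first exact: h.
  by rewrite -cosN -normrN; apply: h; rewrite oppr_ge0.
have [c _] := @MVT_segment R cos (fun x => - sin x) 0 v v0
  (fun x _ => is_derive_cos x) (continuous_subspaceT (@continuous_cos R)).
rewrite cos0 subr0 ger0_norm // => cosE.
have : - sin c * v >= - v by rewrite mulNr lerN2 ler_piMl // sin_le1.
by rewrite -cosE; lra.
Qed.

(** The average over z runs over the multiples j(2u) of one frequency: their cosines add up to at
    most 1/|sin u|, negligible against m unless sin u vanishes. Multiplying by 2 sin u makes the sum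
    telescope. *)
Lemma dirichlet_kernel (R : realType) (u : R) (m : nat) :
  2 * sin u * (\sum_(j < m) cos (j%:R * (2 * u))) =
  sin (m%:R * (2 * u) - u) + sin u.
Proof.
elim: m => [|m IH]; first by rewrite big_ord0 mulr0 mul0r sub0r sinN addNr.
rewrite big_ord_recr /= mulrDr IH.
rewrite (_ : m.+1%:R * (2 * u) - u = m%:R * (2 * u) + u); last by rewrite -natr1; ring.
by rewrite sinB sinD; ring.
Qed.

Lemma dirichlet_kernel_le (R : realType) (u : R) (m : nat) :
  `|sin u| * `|\sum_(j < m) cos (j%:R * (2 * u))| <= 1.
Proof.
rewrite -normrM -(ler_pM2l (_ : 0 < 2)) // mulr1.
rewrite -[X in X * _](ger0_norm (_ : 0 <= 2)) // -normrM mulrA dirichlet_kernel.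
by apply: le_trans (ler_normD _ _) _; rewrite -[2]/(1 + 1) lerD // sin_max.
Qed.

Section measure_lemmas.
Context d (T : measurableType d) (R : realType).

Lemma measure_bigcup_le (mu : {measure set T -> \bar R}) (F : nat -> set T) (c : \bar R) :
  (forall i, measurable (F i)) -> (forall i, F i `<=` F i.+1) ->
  (forall i, (mu (F i) <= c)%E) -> (mu (\bigcup_i F i) <= c)%E.
Proof.
move=> mF Fmon Fc.
have Fhom : {homo F : n m / (n <= m)%N >-> (n <= m)%O}.
  move=> i j /subnK <-; elim: (j - i)%N => // k IH; apply: le_trans IH _.
  exact/subsetPset/Fmon.
have cv := @nondecreasing_cvg_mu _ _ _ mu F mF (bigcupT_measurable _ mF) Fhom.
rewrite -(cvg_lim _ cv) //; apply: lime_le; first by apply/cvg_ex; eexists; exact: cv.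
exact: nearW.
Qed.

Lemma measure_bigsetU_le (mu : {measure set T -> \bar R}) (I : Type) (s : seq I)
    (Q : pred I) (F : I -> set T) : (forall i, measurable (F i)) ->
  (mu (\big[setU/set0]_(i <- s | Q i) F i) <= \sum_(i <- s | Q i) mu (F i))%E.
Proof.
move=> mF; elim: s => [|i s IH]; first by rewrite !big_nil measure0.
rewrite !big_cons; case: ifP => // _.
have mU : measurable (\big[setU/set0]_(j <- s | Q j) F j) by exact: bigsetU_measurable.
by apply: le_trans (measureU2 mu (mF i) mU) _; exact: leeD2l.
Qed.

Lemma markov_set (mu : {measure set T -> \bar R}) (f : T -> R) (E : set T) (c : R) :
  measurable_fun setT f -> (forall w, 0 <= f w) -> measurable E -> 0 <= c ->
  (forall w, E w -> c <= f w) -> (c%:E * mu E <= \int[mu]_w (f w)%:E)%E.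
Proof.
move=> mf f0 mE c0 cf; rewrite -(@integral_cst _ _ _ mu E mE c%:E).
apply: (@le_trans _ _ (\int[mu]_(w in E) (f w)%:E)%E).
  apply: ge0_le_integral => //=.
  exact/measurable_EFinP/measurable_funTS.
apply: ge0_subset_integral => //; first exact/measurable_EFinP.
by move=> w _; rewrite lee_fin.
Qed.

Lemma bounded_Rintegrable (mu : {finite_measure set T -> \bar R}) (f : T -> R) (M : R) :
  measurable_fun setT f -> (forall w, `|f w| <= M) ->
  mu.-integrable setT (EFin \o f).
Proof.
move=> mf fM; apply: measurable_bounded_integrable => //.
  by rewrite -ge0_fin_numE ?fin_num_measure.
exists M; split; first exact: num_real.
by move=> M' MM' w _ /=; apply: le_trans (fM w) _; exact: ltW.
Qed.

Lemma Rintegral_le_cst (mu : {finite_measure set T -> \bar R}) (f : T -> R) (M : R) :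
  measurable_fun setT f -> (forall w, `|f w| <= M) ->
  `|Rintegral mu setT f| <= M * fine (mu setT).
Proof.
move=> mf fM; apply: le_trans (le_normr_Rintegral _ (bounded_Rintegrable mu mf fM)) _ => //.
rewrite -Rintegral_cst //; apply: le_Rintegral => //.
  apply: (@bounded_Rintegrable _ _ M); first exact: measurableT_comp.
  by move=> w; rewrite normr_id.
apply: (@bounded_Rintegrable _ _ `|M|); first exact: measurable_cst.
by [].
Qed.

End measure_lemmas.

Lemma measurable_dotp (R : realType) (n : nat) (z : 'rV[R]_n) :
  measurable_fun setT (fun x : Rn R n => dotp z x).
Proof.
apply: measurable_sum => i; apply: measurable_funM; first exact: measurable_cst.
exact: measurable_coord.
Qed.

(** With L the mass of mu, the real part of the characteristic function is exp(-ta) cos(tb), where 0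
    <= a <= 2L and |b| <= L. The factors are at least 1 - 2tL and 1 - tL, whence the constant 3L. *)
Lemma compound_poisson_cos d (T : measurableType d) (R : realType)
    (P : probability T R) (n : nat) (X : R -> T -> 'rV[R]_n) :
  compound_poisson P X -> exists2 c : R, 0 <= c & forall t z, 0 <= t ->
    1 - c * t <= Rintegral P setT (fun w => cos (dotp z (X t w))).
Proof.
move=> [_ [mu [_ cf]]]; pose L := fine (mu setT).
have L0 : 0 <= L by exact: fine_ge0.
exists (3 * L); first by rewrite mulr_ge0.
move=> t z t0; have := congr1 (@complex.Re R) (cf t z t0).
rewrite /cintegral /= expR0.
under eq_Rintegral do rewrite mul1r.
set a := Rintegral mu _ (fun x => 1 - 1 * _); set b := Rintegral mu _ _.
move=> ->.
have aE : a = Rintegral mu setT (fun x => 1 - cos (dotp z x)).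
  by apply: eq_Rintegral => w _; rewrite mul1r.
have bE : b = Rintegral mu setT (fun x => - sin (dotp z x)).
  by apply: eq_Rintegral => w _; rewrite mul1r sub0r.
have a0 : 0 <= a by rewrite aE; apply: Rintegral_ge0 => x _; rewrite subr_ge0 cos_le1.
have mcos : measurable_fun setT (fun x : Rn R n => cos (dotp z x)).
  by apply: (measurableT_comp _ (measurable_dotp z));
    apply: continuous_measurable_fun; exact: continuous_cos.
have msin : measurable_fun setT (fun x : Rn R n => sin (dotp z x)).
  by apply: (measurableT_comp _ (measurable_dotp z));
    apply: continuous_measurable_fun; exact: continuous_sin.
have a2 : a <= 2 * L.
  rewrite aE; apply: le_trans (ler_norm _) _; apply: Rintegral_le_cst.
    exact: measurable_funB.
  move=> x; rewrite ger0_norm ?subr_ge0 ?cos_le1 // lerBlDr -lerBlDl.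
  by rewrite (_ : 1 - 2 = -1 :> R) ?cos_geN1 //; ring.
have b1 : `|b| <= L.
  rewrite bE -[L]mul1r; apply: Rintegral_le_cst; first exact: measurableT_comp.
  by move=> x; rewrite normrN sin_max.
have tb : cos (- (t * b + 0 * a)) >= 1 - t * L.
  apply: le_trans (cos_ge1B_norm _).
  by rewrite mul0r addr0 normrN normrM (ger0_norm t0) lerD2l lerN2 ler_wpM2l.
have ta : expR (- (t * a - 0 * b)) >= 1 - t * (2 * L).
  apply: le_trans (expR_ge1Dx _).
  by rewrite mul0r subr0 lerD2l lerN2 ler_wpM2l.
have ta1 : expR (- (t * a - 0 * b)) <= 1.
  by rewrite mul0r subr0 expR_le1 oppr_le0 mulr_ge0.
have c1 := cos_le1 (- (t * b + 0 * a)).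
have := expR_ge0 (- (t * a - 0 * b)).
move: ta ta1 tb c1; set e := expR _; set c := cos _ => ta ta1 tb c1 e0.
(* Both factors are at most 1, so e c >= e + c - 1, also when the cosine c is negative. *)
have : 0 <= (1 - e) * (1 - c) by rewrite mulr_ge0 // subr_ge0.
by nra.
Qed.

(** * From means of cosines to the probability of a nonzero value *)

Section neq0_bound.
Context d (T : measurableType d) (R : realType) (P : probability T R).
Variables (Y : T -> R) (c : R).
Hypothesis mY : measurable_fun setT Y.
Hypothesis cY : forall s, 1 - c <= Rintegral P setT (fun w => cos (s * Y w)).

Let measurable_cos s : measurable_fun setT (fun w => cos (s * Y w)).
Proof.
apply: (@measurableT_comp _ _ _ _ _ _ cos).
  by apply: continuous_measurable_fun; exact: continuous_cos.
exact: measurable_funM.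
Qed.

Let measurable_sin s : measurable_fun setT (fun w => sin (s * Y w)).
Proof.
apply: (@measurableT_comp _ _ _ _ _ _ sin).
  by apply: continuous_measurable_fun; exact: continuous_sin.
exact: measurable_funM.
Qed.

Let integral_cos s : (\int[P]_w (1 - cos (s * Y w))%:E <= c%:E)%E.
Proof.
have iC : P.-integrable setT (EFin \o (fun w => cos (s * Y w))).
  by apply: (@bounded_Rintegrable _ _ _ _ _ 1) => // w; exact: cos_max.
have i1 : P.-integrable setT (EFin \o (fun=> 1 : R)).
  by apply: (@bounded_Rintegrable _ _ _ _ _ `|1|) => //; exact: measurable_cst.
have iB : P.-integrable setT (EFin \o (fun w => 1 - cos (s * Y w))).
  by rewrite /comp; under eq_fun do rewrite EFinB; exact: integrableB.
rewrite -[leLHS]fineK; last exact: integrable_fin_num.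
rewrite lee_fin -[leLHS]/(Rintegral P setT (fun w => 1 - cos (s * Y w))).
have P1 : fine (P setT) = 1 by rewrite probability_setT.
rewrite RintegralB // Rintegral_cst // [X in 1 * X]P1 mul1r.
by have := cY s; rewrite lerBlDr -lerBlDl.
Qed.

(** On this set the m+1 cosines add up to at most (m+1)/2, so the terms 1 - cos add up to at least
    (m+1)/2, while their sum has mean at most (m+1)c. Markov's inequality gives 2c, whatever m and u
    are. *)
Let sin_set_bound u m :
  (P [set w | (2 / m.+1%:R <= `|sin (u * Y w)|)%R] <= (2 * c)%:E)%E.
Proof.
set F := mkset _.
have mF : measurable F.
  rewrite (_ : F = (fun w => `|sin (u * Y w)|) @^-1` `[2 / m.+1%:R, +oo[%classic).
    rewrite -[_ @^-1` _]setTI; apply: measurableT_comp => //; exact: measurable_itv.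
  by apply/seteqP; split => w; rewrite /F /= in_itv /= andbT.
have m0 : 0 < m.+1%:R :> R by [].
have Fc w : F w -> m.+1%:R / 2 <= \sum_(j < m.+1) (1 - cos (j%:R * (2 * u) * Y w)).
  rewrite /F /= => Fw; rewrite sumrB sumr_const card_ord.
  have := @dirichlet_kernel_le R (u * Y w) m.+1.
  under eq_bigr do rewrite [2 * _]mulrA [_ * (_ * Y w)]mulrA.
  set S := \sum_(i < m.+1) _ => SD.
  have : 2 / m.+1%:R * `|S| <= 1 by apply: le_trans SD; rewrite ler_wpM2r.
  rewrite -ler_pdivlMl ?divr_gt0 // mulr1 invf_div => Sle.
  have := le_trans (ler_norm S) Sle; lra.
have := @markov_set _ _ _ P _ F _ _ _ mF _ Fc.
move=> markov; rewrite -[P F]fineK ?fin_num_measure // lee_fin.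
suff : ((m.+1%:R / 2 * fine (P F))%:E <= (m.+1%:R * c)%:E)%E.
  by rewrite lee_fin mulrAC -mulrA ler_pM2l // ler_pdivrMr // mulrC.
rewrite EFinM fineK ?fin_num_measure //; apply: le_trans (markov _ _ _) _.
- by apply: measurable_sum => j; apply: measurable_funB.
- by move=> w; apply: sumr_ge0 => j _; rewrite subr_ge0 cos_le1.
- by rewrite divr_ge0.
under eq_integral do rewrite -sumEFin.
rewrite ge0_integral_sum //.
- apply: (@le_trans _ _ (\sum_(j < m.+1) c%:E)%E); first by apply: lee_sum => j _.
  by rewrite sumEFin sumr_const card_ord mulr_natl.
- by move=> j; apply/measurable_EFinP; exact: measurable_funB.
Qed.

Let sin_neq0_bound u : (P [set w | (sin (u * Y w) != 0)%R] <= (2 * c)%:E)%E.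
Proof.
rewrite (_ : mkset _ = \bigcup_m [set w | 2 / m.+1%:R <= `|sin (u * Y w)|]).
  apply: measure_bigcup_le => [m|m|m]; last exact: sin_set_bound; last first.
    move=> w /=; apply: le_trans.
    by rewrite ler_pM2l // lef_pV2 ?posrE // ler_nat.
  rewrite (_ : mkset _ = (fun w => `|sin (u * Y w)|) @^-1` `[2 / m.+1%:R, +oo[%classic).
    rewrite -[_ @^-1` _]setTI; apply: measurableT_comp => //; exact: measurable_itv.
  by apply/seteqP; split => w; rewrite /= in_itv /= andbT.
apply/seteqP; split => w /=; last first.
  by move=> [m _] /=; apply: contraTneq => ->; rewrite normr0 -ltNge divr_gt0.
move=> s0; exists (Num.truncn (2 / `|sin (u * Y w)|)) => //=.
rewrite ler_pdivrMr // mulrC -ler_pdivrMr ?normr_gt0 //.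
exact/ltW/truncnS_gt.
Qed.

(** The sine also vanishes at nonzero multiples of pi, so the argument is halved until it lies in
    (-2, 2), where 0 is the only zero. By the double angle formula the events increase with l, and
    the bound passes to their union. *)
Lemma neq0_bound : (P [set w | (Y w != 0)%R] <= (2 * c)%:E)%E.
Proof.
rewrite (_ : mkset _ = \bigcup_l [set w | sin (2 ^- l * Y w) != 0]).
  apply: measure_bigcup_le => [l|l|l]; last exact: sin_neq0_bound; last first.
    move=> w /=.
    rewrite (_ : 2 ^- l * Y w = (2 ^- l.+1 * Y w) *+ 2); last first.
      by rewrite exprS invfM -!mulrnAl -[2^-1 *+ 2]mulr_natr mulVf ?mul1r // pnatr_eq0.
    by rewrite sin_mulr2n; apply: contraNneq => ->; rewrite mulr0 mul0rn.
  rewrite (_ : mkset _ = (fun w => sin (2 ^- l * Y w)) @^-1` ~` [set 0]).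
    rewrite -[_ @^-1` _]setTI; apply: measurable_sin => //.
    by apply: measurableC; exact: measurable_set1.
  by apply/seteqP; split => w /= /eqP.
apply/seteqP; split => w /=; last first.
  by move=> [l _] /=; apply: contraNneq => ->; rewrite mulr0 sin0.
move=> Y0; exists (Num.truncn `|Y w|) => //=; set l := Num.truncn _.
have Yl : `|2 ^- l * Y w| < 2.
  rewrite normrM ger0_norm ?invr_ge0 ?exprn_ge0 // mulrC ltr_pdivrMr ?exprn_gt0 // -exprS.
  apply: lt_le_trans (truncnS_gt _) _; rewrite -natrX ler_nat -/l.
  exact/ltnW/ltn_expl.
have : 2 ^- l * Y w != 0 by rewrite mulf_neq0 // invr_neq0 // expf_neq0.
move: Yl; set y := _ * Y w => yl; rewrite neq_lt => /orP[y0|y0].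
  rewrite -oppr_eq0 -sinN gt_eqF // sin2_gt0 // oppr_gt0 y0 /=.
  by move: yl; rewrite ltr0_norm.
by rewrite gt_eqF // sin2_gt0 // y0 /=; move: yl; rewrite gtr0_norm.
Qed.

End neq0_bound.

Lemma compound_poisson_neq0 d (T : measurableType d) (R : realType)
    (P : probability T R) (n : nat) (X : R -> T -> 'rV[R]_n) :
  compound_poisson P X -> exists2 c : R, 0 <= c & forall t, 0 <= t ->
    (P [set w | (X t w <> 0)%R] <= (c * t)%:E)%E.
Proof.
move=> cpX; have [c c0 cX] := compound_poisson_cos cpX.
have mX t : 0 <= t -> measurable_fun setT (X t : T -> Rn R n) by case: cpX => -[+ _ _ _] _; exact.
exists (n%:R * (2 * c)); first by rewrite !mulr_ge0.
move=> t t0; pose F i := [set w | X t w ord0 i != 0].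
have mXi i : measurable_fun setT (fun w => X t w ord0 i).
  exact: (measurableT_comp (measurable_coord i) (mX t t0)).
have mF i : measurable (F i).
  rewrite (_ : F i = (fun w => X t w ord0 i) @^-1` ~` [set 0]).
    rewrite -[_ @^-1` _]setTI; apply: mXi => //.
    by apply: measurableC; exact: measurable_set1.
  by apply/seteqP; split => w /= /eqP.
rewrite (_ : mkset _ = \big[setU/set0]_(i < n) F i); last first.
  rewrite -bigcup_seq; apply/seteqP; split => w /=.
    move=> X0; apply: contrapT => h; apply: X0; apply/rowP => i; rewrite mxE.
    apply/eqP; apply: contrapT => /negP Xi; apply: h; exists i => //=.
    by rewrite mem_index_enum.
  by move=> [i _ Fi] X0; move: Fi; rewrite /F /= X0 mxE eqxx.
apply: (@le_trans _ _ (\sum_(i < n) P (F i))%E); first exact: measure_bigsetU_le.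
apply: (@le_trans _ _ (\sum_(i < n) (2 * (c * t))%:E)%E).
  apply: lee_sum => i _; apply: neq0_bound => // s.
  (* Taking z along the i-th axis isolates the i-th coordinate; the union over coordinates costs the
     factor n. *)
  apply: le_trans (cX t (s *: delta_mx ord0 i) t0) _.
  rewrite le_eqVlt; apply/orP; left; apply/eqP; apply: eq_Rintegral => w _.
  congr cos; rewrite /dotp (bigD1 i) //= !mxE !eqxx mulr1 big1 ?addr0 // => j ji.
  by rewrite !mxE (negbTE ji) andbF mulr0 mul0r.
by rewrite sumEFin sumr_const card_ord lee_fin -[_ *+ n]mulr_natl !mulrA.
Qed.

(** * Step paths *)

Lemma dyadic_refine (R : realType) m j M : dyadic R (m + M) (j * 2 ^ M) = dyadic R m j.
Proof. by rewrite /dyadic expnD !natrM -mulf_div divff ?mulr1 // pnatr_eq0 expn_eq0. Qed.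

Lemma dyadic_lt (R : realType) m i j : (i < j)%N -> dyadic R m i < dyadic R m j.
Proof. by move=> ij; rewrite ltr_pM2r ?ltr_nat // invr_gt0 ltr0n expn_gt0. Qed.

Lemma dyadicB (R : realType) m j : dyadic R m j.+1 - dyadic R m j = (2 ^ m)%:R^-1.
Proof. by rewrite -mulrBl -natrB // subSnn mul1r. Qed.

Lemma change_point (T : Type) (f : nat -> T) (a b : nat) : (a <= b)%N -> f a <> f b ->
  exists l, [/\ (a <= l)%N, (l < b)%N & f l <> f l.+1].
Proof.
move=> ab fab; apply: contrapT => h; apply: fab.
elim: b ab h => [|b IH]; first by rewrite leqn0 => /eqP ->.
rewrite leq_eqVlt => /predU1P[-> //|]; rewrite ltnS => ab h.
rewrite IH //; last by move=> [l [al lb fl]]; apply: h; exists l; split => //; exact: ltnW.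
by apply: contrapT => fb; apply: h; exists b.
Qed.

Section increments.
Context d (T : measurableType d) (R : realType) (P : probability T R) (n : nat).
Variables (X : R -> T -> 'rV[R]_n) (c : R).
Hypothesis levyX : levy_process P X.
Hypothesis c0 : 0 <= c.
Hypothesis cX : forall t, 0 <= t -> (P [set w | (X t w <> 0)%R] <= (c * t)%:E)%E.

Let mX t : 0 <= t -> measurable_fun setT (X t : T -> Rn R n).
Proof. by case: levyX => + _ _ _; exact. Qed.

Definition change (a b : R) : set T := [set w | X a w <> X b w].

Lemma measurable_change a b : 0 <= a -> 0 <= b -> measurable (change a b).
Proof.
move=> a0 b0; rewrite (_ : change a b = (fun w => X a w - X b w) @^-1` ~` [set 0]).
  rewrite -[_ @^-1` _]setTI.
  have mB : measurable_fun setT (fun w => X a w - X b w : Rn R n).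
    by apply: measurable_fun_RnB; exact: mX.
  by apply: mB => //; apply: measurableC; exact: borel_set1.
apply/seteqP; split => w /=; first by move=> ab /subr0_eq.
by move=> ab abE; apply: ab; rewrite abE subrr.
Qed.

Let borelC0 : borel (~` [set (0 : 'rV[R]_n)]).
Proof. by apply: measurableC; exact: borel_set1. Qed.

Let changeE a b : change a b = (fun w => X b w - X a w) @^-1` (~` [set (0 : 'rV[R]_n)]).
Proof.
apply/seteqP; split => w /=; first by move=> ab /subr0_eq /esym.
by move=> ab abE; apply: ab; rewrite abE subrr.
Qed.

Lemma change_le a h : 0 <= a -> 0 <= h -> (P (change a (a + h)) <= (c * h)%:E)%E.
Proof.
move=> a0 h0; rewrite changeE.
have [_ _ _ [stat _ _]] := levyX.
by have -> := stat a h _ a0 h0 borelC0; exact: cX.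
Qed.

Section grid.
Variables (g : nat -> R) (h : R).
Hypothesis g0 : 0 <= g 0%N.
Hypothesis gS : forall i, g i.+1 = g i + h.
Hypothesis h0 : 0 < h.

Let g_ge0 i : 0 <= g i.
Proof. by elim: i => // i gi; rewrite gS addr_ge0 // ltW. Qed.

Let g_lt i : g i < g i.+1.
Proof. by rewrite gS ltrDl. Qed.

Lemma change_pair_le i j : (i < j)%N ->
  (P (change (g i) (g i.+1) `&` change (g j) (g j.+1)) <= ((c * h) ^+ 2)%:E)%E.
Proof.
move=> ij; have [_ _ indep _] := levyX.
have ltj : (j < j.+1)%N by [].
have lti : (i < j.+1)%N by exact: ltnW.
have := indep j.+1 g g0 g_lt [set Ordinal lti; Ordinal ltj]%SET (fun=> ~` [set 0])
  (fun=> borelC0).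
rewrite big_setU1 /=; last by rewrite inE -val_eqE /= neq_ltn ij.
rewrite big_set1 /= (_ : \bigcap_(i0 in _) _ =
    change (g i) (g i.+1) `&` change (g j) (g j.+1)); last first.
  rewrite !changeE; apply/seteqP; split => w /=.
    move=> ijP; split; [apply: (ijP (Ordinal lti))|apply: (ijP (Ordinal ltj))];
    by rewrite /= !inE eqxx ?orbT.
  by move=> [iP jP] k /=; rewrite !inE => /orP[]/eqP ->.
move=> ->; rewrite -!changeE expr2 EFinM; apply: lee_pmul => //.
- by rewrite gS; apply: change_le => //; exact: ltW.
- by rewrite gS; apply: change_le => //; exact: ltW.
Qed.

Lemma no_change_prob k :
  P [set w | forall l, (l < k)%N -> X (g l) w = X (g l.+1) w] =
  ((fine (P [set w | X h w = 0])) ^+ k)%:E.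
Proof.
have [_ _ indep [stat _ _]] := levyX.
have := indep k g g0 g_lt [set: 'I_k]%SET (fun=> [set 0]) (fun=> borel_set1 0).
rewrite (_ : \bigcap_(i0 in _) _ =
    [set w | forall l, (l < k)%N -> X (g l) w = X (g l.+1) w]); last first.
  apply/seteqP; split => w /=.
    by move=> wP l lk; have := wP (Ordinal lk); rewrite /= inE => /(_ isT) /subr0_eq.
  by move=> wP l _ /=; rewrite -(wP l) ?subrr.
move=> ->.
rewrite (eq_bigr (fun=> (fine (P [set w | X h w = 0]))%:E)); last first.
  have mh : measurable [set w | X h w = 0].
    by rewrite -[mkset _]setTI; exact: (mX (ltW h0) measurableT (borel_set1 0)).
  move=> i _; rewrite fineK ?fin_num_measure //.
  by have := stat (g i) h _ (g_ge0 i) (ltW h0) (borel_set1 0); rewrite -gS.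
rewrite prodEFin; congr EFin.
by rewrite prodr_const cardsT card_ord.
Qed.

End grid.
End increments.

(** * At most two values on each short dyadic interval *)

Section two_values.
Context d (T : measurableType d) (R : realType) (P : probability T R) (n : nat).
Variables (X : R -> T -> 'rV[R]_n) (c : R).
Hypothesis levyX : levy_process P X.
Hypothesis c0 : 0 <= c.
Hypothesis cX : forall t, 0 <= t -> (P [set w | (X t w <> 0)%R] <= (c * t)%:E)%E.

Let grid m j M i : R := dyadic R (m + M) (j * 2 ^ M + i).

Let grid0 m j M : grid m j M 0%N = dyadic R m j.
Proof. by rewrite /grid addn0 dyadic_refine. Qed.

Let gridN m j M : grid m j M (2 ^ M)%N = dyadic R m j.+1.
Proof. by rewrite /grid -mulSnr dyadic_refine. Qed.

Let gridS m j M i : grid m j M i.+1 = grid m j M i + (2 ^ (m + M))%:R^-1.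
Proof. by rewrite -(dyadicB R (m + M) (j * 2 ^ M + i)) addrC subrK /grid addnS. Qed.

(* The path then changes at least twice along the M-th refinement of the dyadic interval,
   which has probability at most quadratic in its length. *)
Let third_value m j M : set T := [set w | exists i, [/\ (i <= 2 ^ M)%N,
  X (dyadic R m j) w <> X (grid m j M i) w & X (grid m j M i) w <> X (dyadic R m j.+1) w]].

Let measurable_third_value m j M : measurable (third_value m j M).
Proof.
rewrite (_ : third_value m j M = \bigcup_(i in [set i | (i <= 2 ^ M)%N])
    (change X (dyadic R m j) (grid m j M i) `&` change X (grid m j M i) (dyadic R m j.+1))).
  apply: bigcup_measurable => i _.
  by apply: measurableI; apply: (measurable_change levyX); exact: dyadic_ge0.
apply/seteqP; split => w /=; first by move=> [i [iM ? ?]]; exists i.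
by move=> [i iM [? ?]]; exists i.
Qed.

(** A third value forces a change in some grid cell before it and in another one after it. There are
    at most N^2 such pairs of cells, each of probability at most (c h)^2 by independence, and N h =
    2^-m does not depend on M. *)
Let third_value_le m j M : (P (third_value m j M) <= ((c / (2 ^ m)%:R) ^+ 2)%:E)%E.
Proof.
pose N := (2 ^ M)%N; pose g := grid m j M; pose h : R := (2 ^ (m + M))%:R^-1.
pose F (p : 'I_N * 'I_N) := change X (g p.1) (g p.1.+1) `&` change X (g p.2) (g p.2.+1).
have g_ge0 i : 0 <= g i by exact: dyadic_ge0.
have h0 : 0 < h by rewrite invr_gt0 ltr0n expn_gt0.
have mF p : measurable (F p) by apply: measurableI; exact: (measurable_change levyX).
have sub : third_value m j M `<=` \big[setU/set0]_(p : 'I_N * 'I_N | (p.1 < p.2)%N) F p.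
  move=> w [i [iN]]; rewrite -(grid0 m j M) -(gridN m j M) -/g => ne1 ne2.
  have [l [_ li nel]] := @change_point _ (fun i => X (g i) w) 0%N i (leq0n _) ne1.
  have [l' [il' l'N nel']] := @change_point _ (fun i => X (g i) w) i N iN ne2.
  have lN : (l < N)%N by exact: leq_trans li iN.
  rewrite -bigcup_seq_cond; exists (Ordinal lN, Ordinal l'N) => //=.
  by rewrite mem_index_enum /=; exact: leq_trans li il'.
apply: (@le_trans _ _ (P (\big[setU/set0]_(p : 'I_N * 'I_N | (p.1 < p.2)%N) F p))).
  by apply: le_measure; rewrite ?inE //; exact: bigsetU_measurable.
apply: le_trans (measure_bigsetU_le P _ _ mF) _.
apply: (@le_trans _ _ (\sum_(p : 'I_N * 'I_N | (p.1 < p.2)%N) ((c * h) ^+ 2)%:E)%E).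
  apply: lee_sum => -[l l'] /= ll'.
  by apply: (change_pair_le levyX cX (g := g) (h := h)) => //; exact: gridS.
rewrite sumEFin lee_fin sumr_const.
apply: (@le_trans _ _ ((c * h) ^+ 2 *+ (N * N))).
  rewrite ler_wpMn2l ?sqr_ge0 //.
  by apply: leq_trans (max_card _) _; rewrite card_prod card_ord.
rewrite le_eqVlt; apply/orP; left; apply/eqP.
rewrite -[_ *+ _]mulr_natr natrM /h expnD natrM -/N.
by field; rewrite !pnatr_eq0 !expn_eq0.
Qed.

Let third_value_mono m j M : third_value m j M `<=` third_value m j M.+1.
Proof.
move=> w [i [iM ? ?]]; exists i.*2; split; first by rewrite expnS mul2n leq_double.
all: rewrite (_ : grid m j M.+1 i.*2 = grid m j M i) //.
all: rewrite /grid -[RHS](dyadic_refine R _ _ 1) addn1 addnS.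
all: by congr dyadic; rewrite expnS expn1; lia.
Qed.

Let two_values_fail (K m : nat) : set T :=
  \big[setU/set0]_(j < K * 2 ^ m) \bigcup_M third_value m j M.

Let measurable_fail K m : measurable (two_values_fail K m).
Proof. by apply: bigsetU_measurable => j _; exact: bigcupT_measurable. Qed.

(** The quadratic bound c^2 / 4^m beats the number K 2^m of intervals, so failure at every level m
    is null. *)
Let fail_le K m : (P (two_values_fail K m) <= (K%:R * c ^+ 2 / (2 ^ m)%:R)%:E)%E.
Proof.
apply: le_trans (measure_bigsetU_le P _ _ _) _ => [j|]; first exact: bigcupT_measurable.
apply: (@le_trans _ _ (\sum_(j < K * 2 ^ m) ((c / (2 ^ m)%:R) ^+ 2)%:E)%E).
  apply: lee_sum => j _; apply: measure_bigcup_le => M;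
    [exact: measurable_third_value|exact: third_value_mono|exact: third_value_le].
rewrite sumEFin lee_fin sumr_const card_ord -[_ *+ _]mulr_natr natrM.
rewrite le_eqVlt; apply/orP; left; apply/eqP.
by field; rewrite !pnatr_eq0 !expn_eq0.
Qed.

Let fail_null K : P (\bigcap_m two_values_fail K m) = 0%E.
Proof.
have mI : measurable (\bigcap_m two_values_fail K m) by exact: bigcapT_measurable.
apply/eqP; rewrite eq_le measure_ge0 andbT; apply/lee_addgt0Pr => e e0; rewrite add0e.
pose m := Num.truncn (K%:R * c ^+ 2 / e).
apply: (@le_trans _ _ (P (two_values_fail K m))).
  by apply: le_measure; rewrite ?inE //; exact: bigcap_inf.
apply: le_trans (fail_le K m) _; rewrite lee_fin ler_pdivrMr ?ltr0n ?expn_gt0 // [e * _]mulrC.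
rewrite -ler_pdivrMr //; apply: le_trans (ltW (truncnS_gt _)) _.
by rewrite ler_nat -/m ltn_expl.
Qed.

Let dyadic_succ_grid m j M t : 0 <= t -> dyadic R m j <= t < dyadic R m j.+1 ->
  exists2 i, (i <= 2 ^ M)%N & dyadic_succ (m + M) t = grid m j M i.
Proof.
move=> t0 /andP[jt tj].
have e0 k : 0 < (2 ^ k)%:R :> R by rewrite ltr0n expn_gt0.
have tm : 0 <= t * (2 ^ (m + M))%:R by rewrite mulr_ge0.
have lo : (j * 2 ^ M <= Num.truncn (t * (2 ^ (m + M))%:R))%N.
  rewrite truncn_ge_nat // expnD natrM natrM mulrA ler_pM2r //.
  by rewrite -ler_pdivrMr.
have hi : (Num.truncn (t * (2 ^ (m + M))%:R) < j.+1 * 2 ^ M)%N.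
  rewrite truncn_lt_nat // expnD natrM natrM mulrA ltr_pM2r //.
  by rewrite -ltr_pdivlMr.
exists (Num.truncn (t * (2 ^ (m + M))%:R) - j * 2 ^ M).+1.
  by move: hi; rewrite mulSn; lia.
by rewrite /grid addnS subnKC.
Qed.

(** Off the failure event, the values on all refined grids of an interval lie in a two-point set.
    This set is closed, so right-continuity extends the property to every t. *)
Lemma dyadic_two_values : {ae P, forall w, forall K : nat, exists m : nat,
  forall j t, (j < K * 2 ^ m)%N -> 0 <= t -> dyadic R m j <= t < dyadic R m j.+1 ->
  X t w = X (dyadic R m j) w \/ X t w = X (dyadic R m j.+1) w}.
Proof.
have [_ _ _ [_ _ cadX]] := levyX.
have null : P.-negligible (\bigcup_K \bigcap_m two_values_fail K m).
  apply: negligible_bigcup => K; apply/negligibleP; [exact: bigcapT_measurable|exact: fail_null].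
apply: negligibleS (negligibleU cadX null) => w nw.
apply: contrapT => /not_orP[/contrapT [rc _] nf]; apply: nw => K.
have [m nm] : exists m, ~ two_values_fail K m w.
  apply: contrapT => h; apply: nf; exists K => // m _; apply: contrapT => ?.
  by apply: h; exists m.
exists m => j t jK t0 jt.
have vals M : [set X (dyadic R m j) w; X (dyadic R m j.+1) w] (X (dyadic_succ (m + M) t) w).
  have [i iM ->] := dyadic_succ_grid M t0 jt.
  apply: contrapT => /not_orP[n1 n2]; apply: nm.
  rewrite /two_values_fail -bigcup_seq; exists (Ordinal jK); first by rewrite /= mem_index_enum.
  by exists M => //; exists i; split => // /esym.
have cl : closed [set X (dyadic R m j) w; X (dyadic R m j.+1) w].
  by apply: closedU; exact/accessible_closed_set1/hausdorff_accessible/norm_hausdorff.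
have cv := cvg_dyadic_right (g := X ^~ w) t0 (rc t t0).
apply: (closed_cvg _ cl _ _ cv).
exists m => // M /= mM; rewrite -(subnKC mM); exact: vals.
Qed.

End two_values.

Section step_paths.
Context d (T : measurableType d) (R : realType) (P : probability T R) (n : nat).
Variables (X : R -> T -> 'rV[R]_n) (c : R).
Hypothesis levyX : levy_process P X.
Hypothesis c0 : 0 <= c.
Hypothesis cX : forall t, 0 <= t -> (P [set w | (X t w <> 0)%R] <= (c * t)%:E)%E.

Lemma dyadic_values : {ae P, forall w, forall t, 0 <= t ->
  exists m j, X t w = X (dyadic R m j) w}.
Proof.
apply: filterS (dyadic_two_values levyX c0 cX) => w two t t0.
have [m mP] := two (Num.truncn t).+1.
have e0 : 0 < (2 ^ m)%:R :> R by rewrite ltr0n expn_gt0.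
have tm : 0 <= t * (2 ^ m)%:R by rewrite mulr_ge0 // ltW.
have [||->|->] := mP (Num.truncn (t * (2 ^ m)%:R)) t _ t0.
- by rewrite truncn_lt_nat // natrM ltr_pM2r // truncnS_gt.
- by rewrite /dyadic ler_pdivrMr // ltr_pdivlMr // truncn_itv.
- by exists m, (Num.truncn (t * (2 ^ m)%:R)).
- by exists m, (Num.truncn (t * (2 ^ m)%:R)).+1.
Qed.

(** On a first dyadic interval the path takes only the value 0 and its value at the right endpoint;
    if the latter is nonzero, right-continuity at 0 excludes it near 0. *)
Lemma vanish_near0 : {ae P, forall w, exists2 e, 0 < e &
  forall t, 0 <= t -> t < e -> X t w = 0}.
Proof.
have [_ X0 _ [_ _ cadX]] := levyX.
apply: (filterS3 _ _ (dyadic_two_values levyX c0 cX) X0 cadX) => w two w0 [rc _].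
have [m mP] := two 1%N; rewrite mul1n in mP.
have d0 : dyadic R m 0 = 0 by rewrite /dyadic mul0r.
have e0 : 0 < dyadic R m 1 by rewrite -d0 dyadic_lt.
have val t : 0 <= t -> t < dyadic R m 1 -> X t w = 0 \/ X t w = X (dyadic R m 1) w.
  move=> t0 t1; rewrite -[0 in X in X \/ _]w0 -d0; apply: mP => //; first by rewrite expn_gt0.
  by rewrite d0 t0.
have [h0|h0] := pselect (X (dyadic R m 1) w = 0).
  by exists (dyadic R m 1) => // t t0 /(val t t0); rewrite h0 => -[].
have nb : \forall t \near 0^'+, X t w <> X (dyadic R m 1) w.
  have : nbhs (X 0 w) (~` [set X (dyadic R m 1) w]).
    apply: open_nbhs_nbhs; split; last by rewrite w0 /=; exact/nesym.
    by rewrite openC; exact/accessible_closed_set1/hausdorff_accessible/norm_hausdorff.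
  exact: (rc 0 (lexx _)).
have [e /= e00 eP] := nb.
exists (Num.min e (dyadic R m 1)); first by rewrite lt_min e00.
move=> t t0; rewrite lt_min => /andP[te t1].
have [->//|t_neq0] := eqVneq t 0.
have [//|] := val t t0 t1.
suff h : X t w <> X (dyadic R m 1) w by move/h.
apply: eP; last by rewrite lt_neqAle eq_sym t_neq0.
by rewrite /ball_ /= sub0r normrN ger0_norm.
Qed.

(* The paths vanish on [0, K] with positive probability: the grid of mesh 2^-m sees no
   change with probability at least (1 - c 2^-m)^(K 2^m), which is nondecreasing in m. *)
Lemma vanish_event (K : nat) : exists E, [/\ process_sigma X E, P E != 0%E &
  {ae P, forall w, E w -> forall t, 0 <= t -> t < K%:R -> X t w = 0}].
Proof.
have [mX X0 _ [_ _ cadX]] := levyX.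
(* Using dyadic times only keeps E in the sigma-algebra of X. The bound on l is inclusive because
   the strict dyadic successor of some t < K can be K itself. *)
pose E := \bigcap_M \bigcap_(l in [set l | (l <= K * 2 ^ M)%N]) (X (dyadic R M l) @^-1` [set 0]).
have sE : process_sigma X E.
  suff : measurable (E : set (g_sigma_algebraType (process_gen X))) by [].
  apply: bigcapT_measurable => M; apply: bigcap_measurableType => l _.
  apply: sub_sigma_algebra; exists (dyadic R M l), [set 0].
  by split => //; [exact: dyadic_ge0|exact: borel_set1].
exists E; split => //; last first.
  apply: filterS cadX => w [rc _] Ew t t0 tK.
  have cv := cvg_dyadic_right (g := X ^~ w) t0 (rc t t0).
  have cl : closed [set (0 : 'rV[R]_n)].
    exact/accessible_closed_set1/hausdorff_accessible/norm_hausdorff.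
  apply: (closed_cvg _ cl _ _ cv); apply: nearW => M /=.
  apply: Ew => //=.
  by rewrite truncn_lt_nat ?mulr_ge0 // natrM ltr_pM2r // ltr0n expn_gt0.
(* From level M0 on, c 2^-m is at most 1/2, so the bases 1 - c h stay positive. That q is
   nondecreasing is (1 - s)^2 >= 1 - 2s for s = c h. *)
pose M0 := Num.truncn (c * 2).
pose A i := [set w | forall l, (l < K * 2 ^ (M0 + i))%N ->
  X (dyadic R (M0 + i) l) w = X (dyadic R (M0 + i) l.+1) w].
pose h i : R := (2 ^ (M0 + i))%:R^-1.
have h0 i : 0 < h i by rewrite invr_gt0 ltr0n expn_gt0.
have hS i : h i = 2 * h i.+1.
  by rewrite /h addnS expnS natrM invfM mulrA divff ?mul1r // pnatr_eq0.
have ch i : c * h i <= 2^-1.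
  elim: i => [|i IH]; last first.
    apply: le_trans IH; rewrite ler_wpM2l // (hS i).
    by rewrite ler_peMl ?ler1n // ltW.
  rewrite /h addn0 ler_pdivrMr ?ltr0n ?expn_gt0 // mulrC ler_pdivlMr //.
  apply: le_trans (ltW (truncnS_gt _)) _; rewrite ler_nat; exact: ltn_expl.
pose q i := (1 - c * h i) ^+ (K * 2 ^ (M0 + i)).
have qS i : q 0%N <= q i.
  elim: i => // i IH; apply: le_trans IH _.
  rewrite /q addnS expnS mulnCA [leRHS]exprM; apply: lerXn2r; rewrite ?nnegrE.
  - by have := ch i; lra.
  - by rewrite sqr_ge0.
  - by rewrite (hS i); have := sqr_ge0 (c * h i.+1); nra.
have q0 : 0 < q 0%N by rewrite exprn_gt0 //; have := ch 0%N; lra.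
have PA i : (P (A i) >= (q 0%N)%:E)%E.
  rewrite /A (no_change_prob levyX (g := dyadic R (M0 + i)) (h := h i)) //; last 2 first.
  - exact: dyadic_ge0.
  - by move=> l; rewrite /h -(dyadicB R (M0 + i) l) addrC subrK.
  rewrite lee_fin; apply: le_trans (qS i) _.
  have mh : measurable [set w | X (h i) w = 0].
    rewrite -[mkset _]setTI.
    exact: (mX _ (ltW (h0 i)) measurableT _ (borel_set1 0)).
  apply: lerXn2r; rewrite ?nnegrE ?fine_ge0 //; first by have := ch i; lra.
  rewrite -lee_fin fineK ?fin_num_measure // EFinB leeBlDr // -(probability_setT P).
  have -> : setT = [set w | X (h i) w = 0] `|` [set w | X (h i) w <> 0].
    by apply/seteqP; split => // w _; exact: EM.
  have mC : measurable [set w | X (h i) w <> 0] by exact: measurableC.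
  apply: le_trans (measureU2 P mh mC) _; rewrite leeD2l //.
  by apply: cX; exact: ltW.
have mA i : measurable (A i).
  rewrite (_ : A i = \bigcap_(l in [set l | (l < K * 2 ^ (M0 + i))%N])
      ~` change X (dyadic R (M0 + i) l) (dyadic R (M0 + i) l.+1)).
    apply: bigcap_measurableType => l _; apply: measurableC.
    by apply: (measurable_change levyX); exact: dyadic_ge0.
  by apply/seteqP; split => w Aw l lK; [rewrite /change /= Aw|apply: contrapT; exact: Aw].
have Amon : {homo A : n m / (n <= m)%N >-> (m <= n)%O}.
  move=> i j /subnK <-; elim: (j - i)%N => // k; apply: le_trans.
  apply/subsetPset => w; rewrite addSn; set i' := (k + i)%N => Aw l lK.
  have eq l' : dyadic R (M0 + i') l' = dyadic R (M0 + i'.+1) (l'.*2).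
    by rewrite -(dyadic_refine R _ l' 1) addn1 addnS expn1 muln2.
  rewrite !eq doubleS Aw; last by rewrite addnS expnS mulnCA mul2n ltn_double.
  by rewrite Aw // addnS expnS mulnCA mul2n -doubleS ltn_Sdouble.
have mAA : measurable (\bigcap_i A i) by exact: bigcapT_measurable.
have A0 : (P (A 0%N) < +oo)%E by rewrite -ge0_fin_numE ?fin_num_measure.
have cv := @nonincreasing_cvg_mu _ _ _ P A A0 mA mAA Amon.
have PAA : ((q 0%N)%:E <= P (\bigcap_i A i))%E.
  rewrite -(cvg_lim _ cv) //; apply: lime_ge; first by apply/cvg_ex; eexists; exact: cv.
  exact: nearW.
apply: contraTneq q0 => PE0; rewrite -leNgt -lee_fin; apply: le_trans PAA _.
(* A path that starts at 0 and has no change on the grids of level at least M0 lies in E, so a null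
   E would contradict the lower bound. *)
have nE : P.-negligible E.
  by apply/negligibleP => //; exact: process_sigma_measurable sE.
rewrite (_ : P _ = 0%E) //; apply: measure_negligible => //.
apply: negligibleS (negligibleU nE X0) => w Aw.
have [w0|w0] := pselect (X 0 w = 0); last by right.
left => M _ l /= lK.
have -> : dyadic R M l = dyadic R (M0 + M) (l * 2 ^ M0) by rewrite addnC dyadic_refine.
have : (l * 2 ^ M0 <= K * 2 ^ (M0 + M))%N.
  by rewrite addnC expnD mulnA leq_mul2r lK orbT.
elim: (l * 2 ^ M0)%N => [|k IH] kK; first by rewrite /dyadic mul0r.
by rewrite -(Aw M) // IH // ltnW.
Qed.

End step_paths.

(** * Sums *)

Section hitting_time.
Context d (T : measurableType d) (R : realType) (n : nat).
Variables (X : R -> T -> 'rV[R]_n) (C : set 'rV[R]_n) (w : T).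

Lemma hitting_time_eq0P : hitting_time X C w = 0%E <->
  forall e : R, 0 < e -> exists t, [/\ 0 < t, t < e & C (X t w)].
Proof.
split=> [h e e0|h].
  have : (hitting_time X C w < e%:E)%E by rewrite h lte_fin.
  by move=> /ereal_inf_lt[_ [t [t0 Ct] <-]]; rewrite lte_fin => te; exists t.
apply/eqP; rewrite eq_le; apply/andP; split.
  apply/lee_addgt0Pr => e e0; rewrite add0e; have [t [t0 te Ct]] := h e e0.
  by apply: (@le_trans _ _ t%:E); [apply: ereal_inf_lbound; exists t|rewrite lee_fin ltW].
by apply: le_ereal_inf_tmp => _ [t [t0 _] <-]; rewrite lee_fin ltW.
Qed.

Lemma hitting_time_ltyP : (hitting_time X C w < +oo)%E <->
  exists t, 0 < t /\ C (X t w).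
Proof.
split=> [/ereal_inf_lt[_ [t tC _] _]|[t tC]]; first by exists t.
by apply: (@le_lt_trans _ _ t%:E); [apply: ereal_inf_lbound; exists t|exact: ltry].
Qed.

End hitting_time.

Lemma negligible_dirac d d' (S : measurableType d) (T : measurableType d')
    (R : realType) (P : probability T R) (x : S) (N : set (S * T)) :
  ((dirac x : {measure set S -> \bar R}) \x P)%E.-negligible N ->
  P.-negligible [set w | N (x, w)].
Proof.
move=> [M [mM M0 NM]]; exists (xsection M x); split.
- exact: measurable_xsection.
- rewrite -M0 /product_measure1 integral_dirac //= ?diracT ?mul1e //.
  exact: measurable_fun_xsection.
- by move=> w Nw; rewrite /xsection /= inE; exact: NM.
Qed.

Section sum.
Context (R : realType) (n : nat) (d : measure_display) (T : measurableType d).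
Variables (P : probability T R) (X1 X2 : R -> T -> 'rV[R]_n).
Hypothesis levyX1 : levy_process P X1.
Hypothesis indepX12 : independent_processes P X1 X2.
Hypothesis cpX2 : compound_poisson P X2.

Let X t w := X1 t w + X2 t w.

Let mX1 t : 0 <= t -> measurable_fun setT (X1 t : T -> Rn R n).
Proof. by case: levyX1 => + _ _ _; exact. Qed.

Let cX1 : {ae P, forall w, cadlag (fun t => X1 t w)}.
Proof. by case: levyX1 => _ _ _ []. Qed.

Let levyX2 : levy_process P X2. Proof. by case: cpX2. Qed.

Let mX2 t : 0 <= t -> measurable_fun setT (X2 t : T -> Rn R n).
Proof. by case: levyX2 => + _ _ _; exact. Qed.

Let indepX2 t : 0 <= t -> forall A B, process_sigma X1 A -> borel B ->
  P (A `&` X2 t @^-1` B) = (P A * P (X2 t @^-1` B))%E.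
Proof.
move=> t0 A B sA mB; apply: indepX12 => //.
by apply: sub_sigma_algebra; exists t, B.
Qed.

Lemma nearly_borel_summand C : nearly_borel P X C -> nearly_borel P X1 C.
Proof.
move=> nbC nu; have [C1 [C2 [mC1 mC2 C1C CC2 nD]]] := nbC nu.
exists C1, C2; split => //.
have mD : borel (C2 `\` C1) by exact: measurableD.
(* Time is cut at K because in general X2 vanishes with positive probability only on bounded
   intervals. *)
apply: (negligibleS (A := \bigcup_K hits X1 `[0, K%:R[%classic (C2 `\` C1))).
  move=> xw /= [t [t0 Dt]]; exists (Num.truncn t).+1 => //.
  by exists t; split => //=; rewrite in_itv /= t0 truncnS_gt.
apply: negligible_bigcup => K.
have [c c0 cX2] := compound_poisson_neq0 cpX2.
have [E [sE E0 EX2]] := vanish_event levyX2 c0 cX2 K.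
have I0 (t : R) : `[0, K%:R[%classic t -> 0 <= t by rewrite /= in_itv /= => /andP[].
have [|N [mN N0 HN]] := @hits_cover_indep _ _ _ P _ X1 mX1 cX1 nu `[0, K%:R[%classic
  (C2 `\` C1) E (measurable_itv _) I0 mD (process_sigma_measurable mX2 sE)
  (fun A sA => indepX12 sA sE) E0.
  apply: negligibleS (negligibleU nD (negligible_snd nu EX2)).
  move=> [y w] [[t [tK Dt]] [_ /= Ew]].
  have [X20|X20] := pselect (forall t, 0 <= t -> t < K%:R -> X2 t w = 0); last first.
    by right => /(_ Ew).
  left; exists t; split; first exact: I0.
  move: tK; rewrite /= in_itv /= => /andP[t0 tK].
  by rewrite /started_at /= /X X20 // addr0.
exact: (negligible_cover cX1 mN N0 HN).
Qed.

Lemma thin_summand B : thin P X B -> thin P X1 B.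
Proof.
move=> [C [nbC BC thinC]]; exists C; split => //; first exact: nearly_borel_summand.
move=> x; have [c c0 cX2] := compound_poisson_neq0 cpX2.
apply: negligibleS (negligibleU (thinC x) (vanish_near0 levyX2 c0 cX2)) => w /= X1C.
have [[e e0 X20]|] := pselect (exists2 e, 0 < e & forall t, 0 <= t -> t < e -> X2 t w = 0);
  last by right.
left; apply/hitting_time_eq0P => e' e'0.
have [|t [t0]] := (hitting_time_eq0P _ _ _).1 X1C (Num.min e e').
  by rewrite lt_min e0.
rewrite lt_min => /andP[te te'] Ct; exists t; split => //.
by move: Ct; rewrite /started_at /X X20 ?addr0 // ltW.
Qed.

Let nonneg_ray (t : R) : `[0, +oo[%classic t -> 0 <= t.
Proof. by rewrite /= in_itv /= andbT. Qed.

Let pos_ray (t : R) : `]0, +oo[%classic t -> 0 <= t.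
Proof. by rewrite /= in_itv /= andbT => /ltW. Qed.

Let shift m j := shift_law P (mX2 (dyadic_ge0 R m j)).

(* Almost surely X2 takes only the values X2_q with q dyadic, so a set hit by y + X is hit
   by (y + X2_q) + X1 for one of countably many q. *)
Let negligible_sum (nu : probability (Rn R n) R) (I : set R) (D : nat -> nat -> set 'rV[R]_n)
    (H : set (Rn R n * T)) :
  (forall t, I t -> 0 <= t) ->
  H `<=` [set xw | exists t, I t /\ forall m j, D m j (xw.1 + X t xw.2)] ->
  (forall m j, exists N : set (Rn R n * g_sigma_algebraType (process_gen X1)),
    [/\ measurable N, (shift m j nu \x process_prob P mX1)%E N = 0%E &
      hits X1 I (D m j) `&` [set xw | cadlag (fun t => X1 t xw.2)] `<=` N]) ->
  (nu \x P)%E.-negligible H.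
Proof.
move=> I0 HD cov; have [c c0 cX2] := compound_poisson_neq0 cpX2.
have nul : (nu \x P)%E.-negligible (\bigcup_m \bigcup_j [set xw : Rn R n * T |
    hits X1 I (D m j) ((xw.1 : 'rV[R]_n) + X2 (dyadic R m j) xw.2, xw.2)]).
  apply: negligible_bigcup => m; apply: negligible_bigcup => j.
  have [N [mN N0 HN]] := cov m j.
  exact: (negligible_shift cX1 (indepX2 (dyadic_ge0 R m j)) mN N0 HN).
apply: negligibleS (negligibleU nul (negligible_snd nu (dyadic_values levyX2 c0 cX2))).
move=> xw /HD[t [It Dt]].
have [vals|] := pselect (forall t, 0 <= t -> exists m j, X2 t xw.2 = X2 (dyadic R m j) xw.2);
  last by right.
left; have [m [j X2t]] := vals t (I0 t It); exists m => //; exists j => //.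
exists t; split => //=; have := Dt m j; rewrite /X X2t.
by rewrite addrA [_ + X1 t _ + _]addrAC.
Qed.

(** One pair of envelopes for each dyadic q, taken for the law of x + X2_q with x distributed by
    nu. *)
Let shift_envelopes (nu : probability (Rn R n) R) (C : set 'rV[R]_n) :
  nearly_borel P X1 C -> exists CC : nat -> nat -> set 'rV[R]_n * set 'rV[R]_n,
    forall m j, [/\ borel (CC m j).1, borel (CC m j).2, (CC m j).1 `<=` C, C `<=` (CC m j).2 &
    (shift m j nu \x P)%E.-negligible
      (hits X1 `[0, +oo[%classic ((CC m j).2 `\` (CC m j).1))].
Proof.
move=> nbC; have /choice[CC CCP] (p : nat * nat) : exists E : set 'rV[R]_n * set 'rV[R]_n,
    [/\ borel E.1, borel E.2, E.1 `<=` C, C `<=` E.2 &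
    (shift p.1 p.2 nu \x P)%E.-negligible (hits X1 `[0, +oo[%classic (E.2 `\` E.1))].
  have [C1 [C2 [mC1 mC2 C1C CC2 nD]]] := nbC (shift p.1 p.2 nu).
  exists (C1, C2); split => //; apply: negligibleS nD => xw [t [tI Dt]].
  by exists t; split => //; exact: nonneg_ray.
by exists (fun m j => CC (m, j)) => m j; exact: (CCP (m, j)).
Qed.

Lemma polar_sum B : polar P X1 B -> polar P X B.
Proof.
move=> [C [nbC BC polC]]; exists C; split => //.
  move=> nu; have [CC CCP] := shift_envelopes nu nbC.
  (* The gap between these two sets lies in the gap of every single pair, so it is negligible for
     all the shifted laws at once. *)
  exists (\bigcup_m \bigcup_j (CC m j).1), (\bigcap_m \bigcap_j (CC m j).2); split.
  - apply: bigcupT_measurable => m; apply: bigcupT_measurable => j.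
    by case: (CCP m j).
  - apply: bigcapT_measurable => m; apply: bigcapT_measurable => j.
    by case: (CCP m j).
  - by move=> v [m _ [j _]]; case: (CCP m j) => _ _ + _ _; exact.
  - by move=> v Cv m _ j _; case: (CCP m j) => _ _ _ + _; exact.
  apply: (@negligible_sum nu `[0, +oo[%classic (fun m j => (CC m j).2 `\` (CC m j).1)).
  - exact: nonneg_ray.
  - move=> xw /= [t [t0 [D2 D1]]]; exists t; split; first by rewrite in_itv /= t0.
    by move=> m j; split; [exact: D2|move=> C1; apply: D1; exists m => //; exists j].
  - move=> m j; have [mC1 mC2 _ _ nD] := CCP m j.
    by apply: hits_cover => //; exact: measurableD.
move=> x; pose nu : probability (Rn R n) R := dirac (x : Rn R n).
suff : (nu \x P)%E.-negligible
    [set xw : Rn R n * T | exists t, 0 < t /\ C ((xw.1 : 'rV[R]_n) + X t xw.2)].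
  by move=> /negligible_dirac; apply: negligibleS => w /hitting_time_ltyP.
(* Since C need not be Borel, hits of its outer envelopes are estimated instead. *)
have [CC CCP] := shift_envelopes nu nbC.
apply: (@negligible_sum nu `]0, +oo[%classic (fun m j => (CC m j).2)).
- exact: pos_ray.
- move=> xw /= [t [t0 Ct]]; exists t; split; first by rewrite in_itv /= t0.
  by move=> m j; case: (CCP m j) => _ _ _ + _; exact.
(* A hit of the outer envelope falls either in the gap, which is excluded by near Borel
   measurability, or in the inner envelope, a Borel part of C excluded by polarity. *)
move=> m j; have [mC1 mC2 C1C _ nD] := CCP m j.
have mD : borel ((CC m j).2 `\` (CC m j).1) by exact: measurableD.
have [N1 [mN1 N10 HN1]] := @hits_cover _ _ _ P _ X1 mX1 cX1 (shift m j nu) `[0, +oo[%classic _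
  (measurable_itv _) nonneg_ray mD nD.
have [|N2 [mN2 N20 HN2]] := @hits_cover_pointwise _ _ _ P _ X1 mX1 cX1 (shift m j nu)
  `]0, +oo[%classic _ (measurable_itv _) pos_ray mC1.
  move=> y; apply: negligibleS (polC y) => w [t [t0 Ct]].
  apply/hitting_time_ltyP; exists t; split; last exact: C1C.
  by move: t0; rewrite /= in_itv /= andbT.
exists (N1 `|` N2); split; first exact: measurableU.
  have nN : (shift m j nu \x process_prob P mX1)%E.-negligible (N1 `|` N2).
    by apply: negligibleU; apply/negligibleP.
  by apply: measure_negligible nN; exact: measurableU.
move=> xw [[t [t0 Ct]] gw].
have [C1t|C1t] := pselect ((CC m j).1 (xw.1 + X1 t xw.2)).
  by right; apply: HN2; split => //; exists t.
left; apply: HN1; split => //; exists t; split => //.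
by move: t0; rewrite /= !in_itv /= !andbT => /ltW.
Qed.

End sum.

Theorem theorem3p1 (R : realType) (n : nat)
  (d : measure_display) (T : measurableType d) (P : probability T R)
  (X1 X2 : R -> T -> 'rV[R]_n)
  (levyX1 : levy_process P X1)
  (levyX2 : levy_process P X2)
  (indepX12 : independent_processes P X1 X2)
  (huntX1 : hunt_H P X1)
  (cpX2 : compound_poisson P X2) :
  hunt_H P (fun t w => X1 t w + X2 t w).
Proof.
move=> B [N [thinN BN]]; apply: (polar_sum levyX1 indepX12 cpX2).
by apply: huntX1; exists N; split => // k; exact: thin_summand (thinN k).
Qed.
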